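(* Let $E$ be a $C^*$-correspondence over a $C^*$-algebra $\mathcal{A}$ and let $(\sigma,T)$ be a completely bounded covariant representation of $E$ on a Hilbert space $\mathcal{H}$ satisfying: (1) $\|\widetilde{T}\eta\|^2+\|\widetilde{T}_2^*\widetilde{T}\eta\|^2\le 2\|\widetilde{T}^*\widetilde{T}\eta\|^2$ for all $\eta\in E\otimes\mathcal{H}$; (2) $(\sigma,T)$ is bounded below; (3) $(\sigma,T)$ is a completely contractive covariant representation; (4) $\|\widetilde{T}_n^*h\|\to0$ as $n\to\infty$ for all $h\in\mathcal{H}$. Then $(\sigma,T)$ has the GWS-property (generating wandering subspace property).
   Context: A $C^*$-correspondence over $\mathcal{A}$ is a right Hilbert $\mathcal{A}$-module $E$ with a nondegenerate $*$-homomorphism $\phi:\mathcal{A}\to\mathcal{L}(E)$ (adjointable operators), giving a left action $a\cdot x=\phi(a)x$. A covariant representation of $E$ on $\mathcal{H}$ is a pair $(\sigma,T)$ with $\sigma:\mathcal{A}\to B(\mathcal{H})$ a $*$-representation and $T:E\to B(\mathcal{H})$ linear with $T(a\cdot x\cdot b)=\sigma(a)T(x)\sigma(b)$ for $a,b\in\mathcal{A}$, $x\in E$. It is completely bounded (resp. completely contractive) iff $\widetilde{T}(x\otimes h)=T(x)h$ defines a bounded (resp. contractive) operator $\widetilde{T}:E\otimes_\sigma\mathcal{H}\to\mathcal{H}$ (where $E\otimes_\sigma\mathcal{H}$, written $E\otimes\mathcal{H}$, is the interior tensor product Hilbert space); then $\widetilde{T}(\phi(a)\otimes I_{\mathcal{H}})=\sigma(a)\widetilde{T}$.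 $E^{\otimes m}$ is the $m$-fold interior tensor product of $E$ with itself over $\phi$. For $m\ge1$, $\widetilde{T}_m:E^{\otimes m}\otimes\mathcal{H}\to\mathcal{H}$ is $\widetilde{T}_m(x_1\otimes\cdots\otimes x_m\otimes h)=T(x_1)\cdots T(x_m)h$; in particular $\widetilde{T}_2=\widetilde{T}(I_E\otimes\widetilde{T})$. For a closed subspace $\mathcal{K}$, $E^{\otimes m}\otimes\mathcal{K}$ is the closed span in $E^{\otimes m}\otimes\mathcal{H}$ of the vectors $x\otimes k$ ($x\in E^{\otimes m}$, $k\in\mathcal{K}$), and for $m=0$ the convention is $\widetilde{T}_0(E^{\otimes 0}\otimes\mathcal{K})=\mathcal{K}$. $\bigvee$ denotes closed linear span. $(\sigma,T)$ is bounded below if there is $c>0$ with $c\|\eta\|\le\|\widetilde{T}\eta\|$ for all $\eta\in E\otimes\mathcal{H}$. A closed subspace $\mathcal{W}\subseteq\mathcal{H}$ is wandering for $(\sigma,T)$ if $\mathcal{W}\perp\widetilde{T}_m(E^{\otimes m}\otimes\mathcal{W})$ for all $m\ge1$. $(\sigma,T)$ has the GWS-property if there is a wandering subspace $\mathcal{W}$ for $(\sigma,T)$ with $\mathcal{H}=[\mathcal{W}]_{\widetilde{T}}:=\bigvee_{m\ge0}\widetilde{T}_m(E^{\otimes m}\otimes\mathcal{W})$. *)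

(* Defs.v *)
From HB Require Import structures.
From mathcomp Require Import all_boot all_order all_algebra sesquilinear complex.
From mathcomp Require Import all_classical all_reals all_analysis.
Import numFieldNormedType.Exports.
Import Order.TTheory GRing.Theory Num.Theory.
Set Implicit Arguments.
Unset Strict Implicit.
Unset Printing Implicit Defensive.
Local Open Scope classical_set_scope.
Local Open Scope complex_scope.
Local Open Scope ring_scope.

(* All spaces are over the complex numbers R[i], with R : realType.  Norms
   take values in R[i]; they are real and nonnegative there, and [<=] on R[i]
   restricts to the usual order on reals. *)

Section spans.
Context {R : realType} {V : normedModType R[i]}.

Definition lspan (S : set V) : set V :=
  [set v | exists (n : nat) (c : 'I_n -> R[i]) (s : 'I_n -> V),
    (forall i, S (s i)) /\ v = \sum_(i < n) c i *: s i].

Definition closed_span (S : set V) : set V := closure (lspan S).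

Definition closed_subspace (W : set V) : Prop :=
  [/\ closed W, W 0 & forall (l : R[i]) u v, W u -> W v -> W (l *: u + v)].

End spans.

Definition bounded_op {R : realType} {U V : normedModType R[i]} (f : U -> V) :
    Prop :=
  (forall (l : R[i]) u v, f (l *: u + v) = l *: f u + f v) /\
  exists M : R[i], forall u, `|f u| <= M * `|u|.

(* The form [hdot] is the library's positive definite hermitian form, hence
   linear in its first argument and conjugate-linear in the second. *)
HB.mixin Record CompleteNormedModule_isHilbert (R : realType) (H : Type)
    of CompleteNormedModule R[i] H := {
  hdot : {dot H for Num.conj};
  hnormE : forall x : H, `|x| ^+ 2 = hdot x x
}.

#[short(type="hilbertType")]
HB.structure Definition Hilbert (R : realType) :=
  {H of CompleteNormedModule R[i] H & CompleteNormedModule_isHilbert R H}.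

(* By the Riesz representation theorem and nondegeneracy of [hdot] the set
   below is a singleton when [L] is a bounded operator. *)
Definition adj {R : realType} {U V : hilbertType R} (L : U -> V) (v : V) : U :=
  xget 0 [set u | forall w : U, hdot (L w) v = hdot w u].

(* C*-algebras are not assumed to be unital. *)
HB.mixin Record CompleteNormedModule_isCStarAlgebra (R : realType) (A : Type)
    of CompleteNormedModule R[i] A := {
  cmul : A -> A -> A;
  cstar : A -> A;
  cmulA : associative cmul;
  cmulDl : left_distributive cmul +%R;
  cmulDr : right_distributive cmul +%R;
  cmulZl : forall (l : R[i]) a b, cmul (l *: a) b = l *: cmul a b;
  cmulZr : forall (l : R[i]) a b, cmul a (l *: b) = l *: cmul a b;
  cstarK : involutive cstar;
  cstarD : forall a b, cstar (a + b) = cstar a + cstar b;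
  cstarZ : forall (l : R[i]) a, cstar (l *: a) = Num.conj l *: cstar a;
  cstarM : forall a b, cstar (cmul a b) = cmul (cstar b) (cstar a);
  cnormM : forall a b, `|cmul a b| <= `|a| * `|b|;
  cnorm_star : forall a, `|cmul (cstar a) a| = `|a| ^+ 2
}.

#[short(type="cstarAlgType")]
HB.structure Definition CStarAlgebra (R : realType) :=
  {A of CompleteNormedModule R[i] A & CompleteNormedModule_isCStarAlgebra R A}.

Definition cpositive {R : realType} {A : cstarAlgType R} (a : A) : Prop :=
  exists b, a = cmul (cstar b) b.

(* Right Hilbert A-modules; the A-valued inner product is linear in its second
   argument.  Definiteness of [ip] is contained in [ip_norm]. *)
HB.mixin Record CompleteNormedModule_isHilbertModule (R : realType)
    (A : cstarAlgType R) (E : Type) of CompleteNormedModule R[i] E := {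
  ract : E -> A -> E;
  ip : E -> E -> A;
  ractDl : forall x y a, ract (x + y) a = ract x a + ract y a;
  ractDr : forall x a b, ract x (a + b) = ract x a + ract x b;
  ractZl : forall (l : R[i]) x a, ract (l *: x) a = l *: ract x a;
  ractZr : forall (l : R[i]) x a, ract x (l *: a) = l *: ract x a;
  ractM : forall x a b, ract x (cmul a b) = ract (ract x a) b;
  ipD : forall x y z, ip x (y + z) = ip x y + ip x z;
  ipZ : forall (l : R[i]) x y, ip x (l *: y) = l *: ip x y;
  ip_ract : forall x y a, ip x (ract y a) = cmul (ip x y) a;
  ip_star : forall x y, cstar (ip x y) = ip y x;
  ip_pos : forall x, cpositive (ip x x);
  ip_norm : forall x, `|x| ^+ 2 = `|ip x x|
}.

#[short(type="hilbertModType")]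
HB.structure Definition HilbertModule (R : realType) (A : cstarAlgType R) :=
  {E of CompleteNormedModule R[i] E &
        CompleteNormedModule_isHilbertModule R A E}.

(* [lact a] is phi(a).  By [lact_adj] each phi(a) is adjointable, with adjoint
   phi(star a); adjointable maps are automatically bounded and A-linear. *)
HB.mixin Record HilbertModule_isCorrespondence (R : realType)
    (A : cstarAlgType R) (E : Type) of HilbertModule R A E := {
  lact : A -> E -> E;
  lactD : forall a b x, lact (a + b) x = lact a x + lact b x;
  lactZ : forall (l : R[i]) a x, lact (l *: a) x = l *: lact a x;
  lactM : forall a b x, lact (cmul a b) x = lact a (lact b x);
  lact_adj : forall a x y,
    ip (lact a x) y = ip x (lact (cstar a) y) :> A;
  lact_nondegenerate :
    closed_span [set y : E | exists (a : A) (x : E), y = lact a x] = setT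
}.

#[short(type="correspondenceType")]
HB.structure Definition Correspondence (R : realType) (A : cstarAlgType R) :=
  {E of HilbertModule R A E & HilbertModule_isCorrespondence R A E}.

Record starRep {R : realType} (A : cstarAlgType R) (H : hilbertType R) := {
  rep :> A -> H -> H;
  rep_bounded : forall a, bounded_op (rep a);
  repD : forall a b h, rep (a + b) h = rep a h + rep b h;
  repZ : forall (l : R[i]) a h, rep (l *: a) h = l *: rep a h;
  repM : forall a b h, rep (cmul a b) h = rep a (rep b h);
  rep_star : forall a h k, hdot (rep a h) k = hdot h (rep (cstar a) k)
}.

Record covRep {R : realType} {A : cstarAlgType R} (E : correspondenceType A)
    (H : hilbertType R) := {
  sigma : starRep A H;
  covT : E -> H -> H;
  covT_bounded : forall x, bounded_op (covT x);
  covTD : forall x y h, covT (x + y) h = covT x h + covT y h;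
  covTZ : forall (l : R[i]) x h, covT (l *: x) h = l *: covT x h;
  covT_covariant : forall (a b : A) (x : E) h,
    covT (lact a (ract x b)) h = sigma a (covT x (sigma b h))
}.

(* Interior tensor products, i.e. Hausdorff completions of the algebraic
   (balanced) tensor product for the inner product [itens_ip]: complete spaces
   with a balanced bilinear map of dense span carrying that inner product.
   These data determine the pair (carrier, map) up to unique unitary
   isomorphism.  [interiorTensor F E] is F (x)_phi E, as a Hilbert A-module, and
   [interiorTensorRep F s] is F (x)_s H, as a Hilbert space. *)
Record interiorTensor {R : realType} {A : cstarAlgType R}
    (F : hilbertModType A) (E : correspondenceType A) := {
  itens_carrier :> hilbertModType A;
  itens : F -> E -> itens_carrier;
  itensDl : forall x y z, itens (x + y) z = itens x z + itens y z;
  itensDr : forall x y z, itens x (y + z) = itens x y + itens x z;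
  itensZl : forall (l : R[i]) x y, itens (l *: x) y = l *: itens x y;
  itensZr : forall (l : R[i]) x y, itens x (l *: y) = l *: itens x y;
  itens_balanced : forall x (a : A) y, itens (ract x a) y = itens x (lact a y);
  itens_ract : forall x y (a : A), ract (itens x y) a = itens x (ract y a);
  itens_ip : forall x y x' y',
    ip (itens x y) (itens x' y') = ip y (lact (ip x x' : A) y') :> A;
  itens_dense :
    closed_span [set z | exists x y, z = itens x y] = setT
}.

Record interiorTensorRep {R : realType} {A : cstarAlgType R}
    (F : hilbertModType A) (H : hilbertType R) (s : starRep A H) := {
  htens_carrier :> hilbertType R;
  htens : F -> H -> htens_carrier;
  htensDl : forall x y h, htens (x + y) h = htens x h + htens y h;
  htensDr : forall x h k, htens x (h + k) = htens x h + htens x k;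
  htensZl : forall (l : R[i]) x h, htens (l *: x) h = l *: htens x h;
  htensZr : forall (l : R[i]) x h, htens x (l *: h) = l *: htens x h;
  htens_balanced : forall x (a : A) h, htens (ract x a) h = htens x (s a h);
  htens_dot : forall x h x' h',
    hdot (htens x h) (htens x' h') = hdot h (s (ip x x' : A) h');
  htens_dense :
    closed_span [set z | exists x h, z = htens x h] = setT
}.

(* In the next section [tensE] and [tensH] are fixed, arbitrary choices of the
   interior tensor products.  Indices are shifted by one: [tpow m] is
   E^{(x)(m+1)}, and [Ttilde m] is T~_{m+1}; thus [Ttilde 0] is T~. *)
Section covariant_representation.
Context {R : realType} {A : cstarAlgType R} {E : correspondenceType A}
  {H : hilbertType R} (V : covRep E H)
  (tensE : forall F : hilbertModType A, interiorTensor F E)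
  (tensH : forall F : hilbertModType A, interiorTensorRep F (sigma V)).

Fixpoint tpow (m : nat) : hilbertModType A :=
  if m is m'.+1 then tensE (tpow m') : hilbertModType A
  else E : hilbertModType A.

Definition tpowH (m : nat) : hilbertType R := tensH (tpow m).

(* x_0 (x) ... (x) x_m *)
Fixpoint etens (m : nat) (x : nat -> E) : tpow m :=
  match m return tpow m with
  | 0%N => x 0%N
  | m'.+1 => itens (tensE (tpow m')) (etens m' x) (x m'.+1)
  end.

(* T(x_0) ... T(x_m) h *)
Fixpoint Tprod (m : nat) (x : nat -> E) (h : H) : H :=
  if m is m'.+1 then Tprod m' x (covT V (x m) h) else covT V (x 0%N) h.

Definition is_Ttilde (m : nat) (L : tpowH m -> H) : Prop :=
  bounded_op L /\
  forall x h, L (htens (tensH (tpow m)) (etens m x) h) = Tprod m x h.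

(* [is_Ttilde m] has at most one solution (elementary tensors span a dense
   subspace), and exactly one for completely bounded representations. *)
Definition Ttilde (m : nat) (eta : tpowH m) : H :=
  xget (fun=> 0) [set L : tpowH m -> H | is_Ttilde L] eta.

Definition completely_bounded : Prop :=
  exists L : tpowH 0 -> H, is_Ttilde L.

Definition completely_contractive : Prop :=
  exists L : tpowH 0 -> H,
    is_Ttilde L /\ forall eta, `|L eta| <= `|eta|.

Definition bounded_below : Prop :=
  exists2 c : R[i], 0 < c &
    forall eta : tpowH 0, c * `|eta| <= `|Ttilde eta|.

(* E^{(x)(m+1)} (x) K *)
Definition tens_sub (m : nat) (K : set H) : set (tpowH m) :=
  closed_span [set z | exists x, exists2 k, K k &
                       z = htens (tensH (tpow m)) x k].

Definition wandering (W : set H) : Prop :=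
  closed_subspace W /\
  forall m w (eta : tpowH m), W w -> tens_sub W eta ->
    hdot w (Ttilde eta) = 0.

Definition generated (W : set H) : set H :=
  closed_span (W `|` \bigcup_m (@Ttilde m @` @tens_sub m W)).

Definition GWS_property : Prop :=
  exists2 W : set H, wandering W & generated W = setT.

End covariant_representation.

Arguments is_Ttilde {R A E H V} tensE tensH m L.
Arguments Ttilde {R A E H V} tensE tensH m eta.
Arguments tens_sub {R A E H V} tensE tensH m K.

(* Main.v *)
Require Import Defs.
From mathcomp Require Import all_boot all_order all_algebra complex.
From mathcomp Require Import all_classical all_reals all_analysis.
From mathcomp Require Import sesquilinear ring lra.
Import numFieldNormedType.Exports.
Import Order.TTheory GRing.Theory Num.Theory.
Set Implicit Arguments.
Unset Strict Implicit.
Unset Printing Implicit Defensive.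
Local Open Scope classical_set_scope.
Local Open Scope complex_scope.
Local Open Scope ring_scope.

(* Let W be the kernel of T~*, and let h be orthogonal to [W]_T~.  Then h and
   every T~_m* h lie in the closure of the range of I (x) T~.  Hypothesis (1)
   says that 2 S^2 - S - S N S is positive, where S = T~* T~ and N is
   I (x) T~ T~*; positivity survives tensoring with E^{(x)m} because this
   operator commutes with the left action.  Hence
   a_m + a_{m+2} <= 2 a_{m+1} for a_m = |T~_m* h|^2: the sequence is concave and
   nonnegative, so nondecreasing, and by (4) it tends to 0, so h = 0.

   Square roots of positive operators are avoided: if S is self-adjoint and
   commutes with the action, the numbers |(I (x) S^n) v|^2 are log-convex in n
   and grow at most like |S|^(2n), which bounds I (x) S by |S|; positivity of
   I (x) Q follows from |M - Q| <= M. *)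

(** In [tpow] each new factor of E is added on the right and H comes last, so T~_{m+2} is T~_{m+1}
    after I (x) T~, where T~ acts on the last copy of E together with H. This forces (F (x) E) (x) K
    to be read as F (x) (E (x) K), with E (x) K in the role of K. The tensor products are known only
    by their inner products and dense spans. Hence an operator I (x) X, or the representation phi(.)
    (x) I on E (x) K, is not given: it must be extended from elementary tensors. The obstacle is a
    bound on sums of z_i (x) X k_i that depends only on the sum of z_i (x) k_i, which no termwise
    estimate gives. All such bounds are derived from inner products. Since the algebra may lack a
    unit, contractivity of representations is replaced by the cruder bound 2 |a|. Only the order of
    magnitude matters: the growth argument absorbs constant factors. *)

(** * Real-valued norms, closures and limits *)

Section normed.
Context {R : realType}.
Implicit Types (V : normedModType R[i]).

(** The library norm takes values in the partially ordered field R[i]; the real version lives in a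
    totally ordered field, where real arithmetic tactics apply. *)
Definition rnorm V (x : V) : R := complex.Re `|x|.

Lemma ReD (a b : R[i]) : complex.Re (a + b) = complex.Re a + complex.Re b.
Proof. by case: a b => [? ?] [? ?]. Qed.

Lemma ReN (a : R[i]) : complex.Re (- a) = - complex.Re a.
Proof. by case: a. Qed.

Lemma ReRM (t : R) (a : R[i]) : complex.Re (t%:C * a) = t * complex.Re a.
Proof. by case: a => a b /=; rewrite mul0r subr0. Qed.

Lemma rnormE V (x : V) : `|x| = (rnorm x)%:C.
Proof.
by rewrite /rnorm RRe_real // ger0_real.
Qed.

Lemma rnorm_ge0 V (x : V) : 0 <= rnorm x.
Proof. by have := normr_ge0 x; rewrite rnormE lecR. Qed.

Lemma rnormD V (x y : V) : rnorm (x + y) <= rnorm x + rnorm y.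
Proof. by have := ler_normD x y; rewrite !rnormE -raddfD lecR. Qed.

Lemma rnormN V (x : V) : rnorm (- x) = rnorm x.
Proof. by rewrite /rnorm normrN. Qed.

Lemma rdistC V (x y : V) : rnorm (x - y) = rnorm (y - x).
Proof. by rewrite -rnormN opprB. Qed.

Lemma rnorm0 V : rnorm (0 : V) = 0.
Proof. by rewrite /rnorm normr0. Qed.

Lemma rnorm_eq0 V (x : V) : rnorm x = 0 -> x = 0.
Proof. by move=> h; apply/eqP; rewrite -normr_eq0 rnormE h. Qed.

Lemma rnorm_small V (x : V) :
  (forall e : R, 0 < e -> rnorm x <= e) -> x = 0.
Proof.
move=> h; apply: rnorm_eq0; apply/eqP; rewrite eq_le rnorm_ge0 andbT.
by apply/ler_addgt0Pr => e /h; rewrite add0r.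
Qed.

Definition cabs (c : R[i]) : R := complex.Re `|c|.

Lemma cabsE (c : R[i]) : `|c| = (cabs c)%:C.
Proof. by rewrite /cabs RRe_real // ger0_real. Qed.

Lemma cabs_ge0 (c : R[i]) : 0 <= cabs c.
Proof. by have := normr_ge0 c; rewrite cabsE lecR. Qed.

Lemma cabs_real (t : R) : cabs t%:C = `|t|.
Proof. by rewrite /cabs normc_def /= expr0n addr0 sqrtr_sqr. Qed.

Lemma rnormZ V (c : R[i]) (x : V) : rnorm (c *: x) = cabs c * rnorm x.
Proof. by rewrite {1}/rnorm normrZ cabsE rnormE -rmorphM. Qed.

Lemma rdistD V (x y z : V) : rnorm (x - z) <= rnorm (x - y) + rnorm (y - z).
Proof. by rewrite (le_trans _ (rnormD _ _)) // addrA subrK. Qed.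

Lemma rnormB V (x y : V) : rnorm (x - y) <= rnorm x + rnorm y.
Proof. by rewrite (le_trans (rnormD _ _)) // rnormN. Qed.

Lemma closureP V (S : set V) (x : V) :
  closure S x <-> forall e : R, 0 < e -> exists2 y, S y & rnorm (x - y) < e.
Proof.
split=> [h e e0|h B /nbhs_ballP[e /= e0 eB]].
- have [] := h (ball x e%:C); first by apply: nbhsx_ballx; rewrite ltcR.
  by move=> y [Sy]; rewrite -ball_normE /= rnormE ltcR; exists y.
- have er : e = (complex.Re e)%:C by rewrite RRe_real // gtr0_real.
  have [|y Sy xy] := h (complex.Re e); first by rewrite -ltcR -er.
  by exists y; split=> //; apply: eB; rewrite -ball_normE /= rnormE er ltcR.
Qed.

Lemma cauchy_limit (V : completeNormedModType R[i]) (u : nat -> V) :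
  (forall e : R, 0 < e ->
     exists N, forall n m, (N <= n)%N -> (N <= m)%N -> rnorm (u n - u m) < e) ->
  exists l, forall e : R, 0 < e ->
     exists N, forall n, (N <= n)%N -> rnorm (l - u n) < e.
Proof.
move=> h; have : cvg (u @ \oo).
  apply: cauchy_cvg; apply/cauchyP => e e0.
  have er : e = (complex.Re e)%:C by rewrite RRe_real // gtr0_real.
  have [|N hN] := h (complex.Re e); first by rewrite -ltcR -er.
  exists (u N); exists N => // n /= Nn.
  by rewrite -ball_normE /= rnormE er ltcR hN.
move=> /cvg_ex[l ul]; exists l => e e0.
have [|N _ hN] := ul (ball l e%:C); first by apply: nbhsx_ballx; rewrite ltcR.
by exists N => n Nn; have := hN n Nn; rewrite -ball_normE /= rnormE ltcR.
Qed.

Lemma invSn_lt (e : R) :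
  0 < e -> exists N, forall n, (N <= n)%N -> n.+1%:R^-1 < e.
Proof.
move=> e0; exists (Num.truncn e^-1) => n Nn.
rewrite -[ltRHS]invrK ltf_pV2 ?posrE ?invr_gt0 //.
by rewrite (lt_le_trans (Num.Theory.truncnS_gt _)) // ler_nat ltnS.
Qed.

Lemma bounded_opP (U V : normedModType R[i]) (f : U -> V) :
  bounded_op f <-> (forall (l : R[i]) u v, f (l *: u + v) = l *: f u + f v) /\
    exists2 M : R, 0 < M & forall u, rnorm (f u) <= M * rnorm u.
Proof.
split=> -[fl].
- move=> [M fM]; split=> //; exists (`|complex.Re M| + 1) => [|u].
    by rewrite ltr_wpDl.
  have := fM u; rewrite !rnormE lecE [M * _]mulrC ReRM.
  move=> /andP[_] /le_trans; apply.
  by rewrite mulrC ler_wpM2r ?rnorm_ge0 // (le_trans (ler_norm _)) // lerDl.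
- move=> [M M0 fM]; split=> //; exists M%:C => u.
  by rewrite !rnormE -rmorphM lecR.
Qed.


(** * Linear and bounded maps *)

Definition lin (U V : normedModType R[i]) (f : U -> V) :=
  forall (l : R[i]) u v, f (l *: u + v) = l *: f u + f v.

Definition rbounded (U V : normedModType R[i]) (f : U -> V) :=
  exists2 M : R, 0 < M & forall u, rnorm (f u) <= M * rnorm u.

Section lin.
Context (U V : normedModType R[i]) (f : U -> V) (fl : lin f).

Lemma lin0 : f 0 = 0.
Proof.
have := fl 1 0 0; rewrite !scale1r addr0 => /eqP.
by rewrite -subr_eq subrr eq_sym => /eqP.
Qed.

Lemma linD u v : f (u + v) = f u + f v.
Proof. by have := fl 1 u v; rewrite !scale1r. Qed.

Lemma linZ c u : f (c *: u) = c *: f u.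
Proof. by have := fl c u 0; rewrite lin0 !addr0. Qed.

Lemma linN u : f (- u) = - f u.
Proof. by rewrite -scaleN1r linZ scaleN1r. Qed.

Lemma linB u v : f (u - v) = f u - f v.
Proof. by rewrite linD linN. Qed.

End lin.

Lemma lin_comp (U V W : normedModType R[i]) (f : V -> W) (g : U -> V) :
  lin f -> lin g -> lin (f \o g).
Proof. by move=> fl gl l u v /=; rewrite gl fl. Qed.

Lemma rbounded_comp (U V W : normedModType R[i]) (f : V -> W) (g : U -> V) :
  rbounded f -> rbounded g -> rbounded (f \o g).
Proof.
move=> [M M0 fM] [N N0 gN]; exists (M * N) => [|u /=]; first exact: mulr_gt0.
by rewrite (le_trans (fM _)) // -mulrA ler_pM2l.
Qed.

(** * Linear combinations, closed spans and extension of bounded maps *)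

Section comb.
Context {X : Type}.
Implicit Types (l : seq (R[i] * X)).

(** Coefficients are attached to indices in [X], not to vectors, so that one list can be evaluated
    along two families and the results compared. *)
Definition comb V (g : X -> V) l : V := \sum_(p <- l) p.1 *: g p.2.

Lemma comb_cat V (g : X -> V) l l' : comb g (l ++ l') = comb g l + comb g l'.
Proof. by rewrite /comb big_cat. Qed.

Lemma comb_scale V (g : X -> V) c l :
  comb g [seq (c * p.1, p.2) | p <- l] = c *: comb g l.
Proof.
by rewrite /comb big_map scaler_sumr; apply: eq_bigr => p _; rewrite scalerA.
Qed.

Lemma comb1 V (g : X -> V) x : comb g [:: (1, x)] = g x.
Proof. by rewrite /comb big_seq1 scale1r. Qed.

Lemma lin_comb (U V : normedModType R[i]) (f : U -> V) (g : X -> U) l :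
  lin f -> f (comb g l) = comb (f \o g) l.
Proof.
move=> fl; rewrite /comb; elim: l => [|p l ih]; first by rewrite !big_nil lin0.
by rewrite !big_cons fl ih.
Qed.

Definition spanning V (g : X -> V) :=
  forall v (e : R), 0 < e -> exists l, rnorm (v - comb g l) < e.

Lemma lspan_rangeP V (g : X -> V) v :
  lspan (range g) v <-> exists l, v = comb g l.
Proof.
split=> [[n [c [s [Ss ->]]]]|[l ->]].
  have /choice[f fs] : forall i, exists x, g x = s i.
    by move=> i; have [x _ <-] := Ss i; exists x.
  exists [seq (c i, f i) | i <- enum 'I_n].
  by rewrite /comb big_map big_enum; apply: eq_bigr => i _; rewrite fs.
exists (size l), (fun i => (tnth (in_tuple l) i).1),
  (fun i => g (tnth (in_tuple l) i).2).
split=> [i|]; first by exists (tnth (in_tuple l) i).2.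
by rewrite /comb big_tnth.
Qed.

Lemma closed_span_rangeP V (g : X -> V) v :
  closed_span (range g) v <->
  forall e : R, 0 < e -> exists l, rnorm (v - comb g l) < e.
Proof.
rewrite /closed_span closureP; split=> h e /h.
  by move=> [_ /lspan_rangeP[l ->]]; exists l.
by move=> [l vl]; exists (comb g l) => //; apply/lspan_rangeP; exists l.
Qed.

Lemma spanningP V (g : X -> V) : spanning g <-> closed_span (range g) = setT.
Proof.
split=> [h|h v e e0].
  apply/seteqP; split=> v _ //. apply/closed_span_rangeP => e e0.
  exact: h.
by apply: (closed_span_rangeP g v).1 e e0; rewrite h.
Qed.

End comb.

Lemma closed_spanP (V : normedModType R[i]) (S : set V) v :
  closed_span S v <-> forall e : R, 0 < e ->
    exists l : seq (R[i] * {x | S x}), rnorm (v - comb sval l) < e.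
Proof.
rewrite -closed_span_rangeP; suff -> : range (@sval V S) = S by [].
by apply/seteqP; split=> [_ [[x Sx] _ <-]//|x Sx]; exists (exist _ x Sx).
Qed.

Lemma sub_closed_span (V : normedModType R[i]) (S : set V) :
  S `<=` closed_span S.
Proof.
move=> x Sx; apply/closed_spanP => e e0.
by exists [:: (1, exist _ x Sx)]; rewrite comb1 subrr rnorm0.
Qed.

Lemma closed_subspace_span (V : normedModType R[i]) (S : set V) :
  closed_subspace (closed_span S).
Proof.
split; first exact: closed_closure.
  apply/closed_spanP => e e0; exists [::].
  by rewrite /comb big_nil subr0 rnorm0.
move=> c u v /closed_spanP Su /closed_spanP Sv; apply/closed_spanP => e e0.
have c0 : 0 < cabs c + 1 by rewrite ltr_wpDl ?cabs_ge0.
have [|l ul] := Su (e / 2 / (cabs c + 1)); first by rewrite !divr_gt0.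
have [|l' vl'] := Sv (e / 2); first by rewrite divr_gt0.
exists ([seq (c * p.1, p.2) | p <- l] ++ l').
rewrite comb_cat comb_scale opprD addrACA -scalerBr.
rewrite (le_lt_trans (rnormD _ _)) // [e]splitr ltr_leD ?ltW //.
rewrite rnormZ (@le_lt_trans _ _ ((cabs c + 1) * rnorm (u - comb sval l))) //.
  by rewrite ler_wpM2r ?rnorm_ge0 // lerDl.
by rewrite mulrC -ltr_pdivlMr.
Qed.

Lemma closed_span_min (V : normedModType R[i]) (S W : set V) :
  closed_subspace W -> S `<=` W -> closed_span S `<=` W.
Proof.
move=> [cW W0 lW] SW v /closed_spanP Sv; apply: cW; apply/closureP => e /Sv.
move=> [l vl]; exists (comb sval l) => //; elim: l {vl} => [|p l ih].
  by rewrite /comb big_nil.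
by rewrite /comb big_cons; apply: lW => //; apply: SW; apply: svalP.
Qed.

Lemma eq_closed_span (U V : normedModType R[i]) (f g : U -> V) (S : set U) :
  lin f -> lin g -> rbounded f -> rbounded g -> (forall x, S x -> f x = g x) ->
  forall x, closed_span S x -> f x = g x.
Proof.
move=> fl gl [M M0 fM] [N N0 gN] fg x Sx.
have W : closed_subspace [set x | f x = g x].
  split; last by move=> c u v /= fu fv; rewrite fl gl fu fv.
    move=> u /closureP Su; apply/eqP; rewrite -subr_eq0; apply/eqP.
    apply: rnorm_eq0; apply/eqP; rewrite eq_le rnorm_ge0 andbT.
    apply/ler_addgt0Pr => e e0; rewrite add0r.
    have MN : 0 < M + N by rewrite addr_gt0.
    have [|y fy uy] := Su (e / (M + N)); first by rewrite divr_gt0.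
    have -> : f u - g u = f (u - y) - g (u - y).
      by rewrite (linB fl) (linB gl) fy opprB addrA subrK.
    rewrite (le_trans (rnormB _ _)) // (le_trans (lerD (fM _) (gN _))) //.
    by rewrite -mulrDl mulrC -ler_pdivlMr // ltW.
  by rewrite /= !lin0.
exact: (closed_span_min W fg).
Qed.

(* The graph of [L] is the closure of the span of the pairs [(g x, f x)]. *)
Lemma spanning_extension (X : Type) (U : normedModType R[i])
    (V : completeNormedModType R[i]) (g : X -> U) (f : X -> V) (C : R) :
  0 < C -> spanning g -> (forall l, rnorm (comb f l) <= C * rnorm (comb g l)) ->
  exists L : U -> V, [/\ lin L, forall u, rnorm (L u) <= C * rnorm u &
    forall x, L (g x) = f x].
Proof.
move=> C0 gt fg.
pose G u v := forall e : R, 0 < e ->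
  exists l, rnorm (u - comb g l) < e /\ rnorm (v - comb f l) < e.
have Glin c u v u' v' : G u v -> G u' v' -> G (c *: u + u') (c *: v + v').
  move=> Guv Guv' e e0.
  have c0 : 0 < cabs c + 1 by rewrite ltr_wpDl ?cabs_ge0.
  have [|l [ul vl]] := Guv (e / 2 / (cabs c + 1)); first by rewrite !divr_gt0.
  have [|l' [ul' vl']] := Guv' (e / 2); first by rewrite divr_gt0.
  exists ([seq (c * p.1, p.2) | p <- l] ++ l').
  have H (W : normedModType R[i]) (w w' : W) (h : X -> W) :
      rnorm (w - comb h l) < e / 2 / (cabs c + 1) ->
      rnorm (w' - comb h l') < e / 2 ->
      rnorm (c *: w + w' - comb h ([seq (c * p.1, p.2) | p <- l] ++ l')) < e.
    move=> wl wl'; rewrite comb_cat comb_scale opprD addrACA -scalerBr.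
    rewrite (le_lt_trans (rnormD _ _)) // [ltRHS]splitr ltr_leD ?ltW //.
    rewrite rnormZ (@le_lt_trans _ _ ((cabs c + 1) * rnorm (w - comb h l))) //.
      by rewrite ler_wpM2r ?rnorm_ge0 // lerDl.
    by rewrite mulrC -ltr_pdivlMr.
  by split; apply: H.
have Gbound u v : G u v -> rnorm v <= C * rnorm u.
  move=> Guv; apply/ler_addgt0Pr => e e0.
  have C1 : 0 < C + 1 by rewrite addr_gt0.
  have [|l [ul vl]] := Guv (e / (C + 1)); first by rewrite divr_gt0.
  have h1 : rnorm v <= rnorm (v - comb f l) + rnorm (comb f l).
    by rewrite -{1}(subrK (comb f l) v) rnormD.
  have h2 : rnorm (comb g l) <= rnorm (u - comb g l) + rnorm u.
    by rewrite rdistC -{1}(subrK u (comb g l)) rnormD.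
  have h3 : C * rnorm (comb g l) <= C * (rnorm (u - comb g l) + rnorm u).
    by rewrite ler_pM2l.
  have h4 : (C + 1) * (e / (C + 1)) = e by rewrite mulrC divfK // gt_eqF.
  have h5 : C * rnorm (u - comb g l) <= C * (e / (C + 1)).
    by rewrite ler_pM2l // ltW.
  move: (fg l) h1 h3 vl h4 h5; set d := e / (C + 1); lra.
have Gex u : exists v, G u v.
  have /choice[l lP] : forall n : nat, exists l,
      rnorm (u - comb g l) < n.+1%:R^-1.
    by move=> n; apply: gt; rewrite invr_gt0.
  have [|v hv] := @cauchy_limit V (fun n => comb f (l n)).
    move=> e e0; have C1 : 0 < 2 * C by rewrite mulr_gt0.
    have [|N hN] := @invSn_lt (e / (2 * C)); first by rewrite divr_gt0.
    exists N => n m Nn Nm.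
    (* A difference of two combinations is again a combination, so the bound [fg] applies to it. *)
    have E (W : normedModType R[i]) (h : X -> W) : comb h (l n) - comb h (l m) =
        comb h (l n ++ [seq (-1 * p.1, p.2) | p <- l m]).
      by rewrite comb_cat comb_scale scaleN1r.
    rewrite E (le_lt_trans (fg _)) // -E.
    have h1 := rdistD (comb g (l n)) u (comb g (l m)).
    have h2 := lt_trans (lP n) (hN _ Nn); have h3 := lt_trans (lP m) (hN _ Nm).
    rewrite rdistC in h2.
    have h4 : C * rnorm (comb g (l n) - comb g (l m)) < C * (2 * (e / (2 * C))).
      by rewrite ltr_pM2l //; lra.
    by rewrite (lt_le_trans h4) // mulrCA mulrA mulrC divfK // gt_eqF.
  exists v => e e0; have [N hN] := invSn_lt e0; have [M hM] := hv e e0.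
  exists (l (maxn N M)); split; last by rewrite hM ?leq_maxr.
  by rewrite (lt_trans (lP _)) // hN ?leq_maxl.
have Guniq u v v' : G u v -> G u v' -> v = v'.
  move=> Gv Gv'; have := Gbound _ _ (Glin (-1) _ _ _ _ Gv Gv').
  rewrite !scaleN1r addNr rnorm0 mulr0 => h; apply/eqP.
  rewrite eq_sym -subr_eq0 addrC; apply/eqP; apply: rnorm_eq0.
  by apply/eqP; rewrite eq_le h rnorm_ge0.
have [L LG] := choice Gex; exists L; split=> [c u v|u|x].
- exact: Guniq (LG _) (Glin c _ _ _ _ (LG u) (LG v)).
- exact: Gbound.
- apply: (Guniq (g x)) => // e e0; exists [:: (1, x)].
  by rewrite !comb1 !subrr !rnorm0.
Qed.

End normed.

(** * Hilbert spaces: orthogonal projection, Riesz representation, adjoints *)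

Section hilbert.
Context {R : realType}.
Implicit Types (H : hilbertType R).

Definition rdot H (x y : H) : R := complex.Re (hdot x y).

Lemma hdotDl H (x y z : H) : hdot (x + y) z = hdot x z + hdot y z.
Proof. exact: linearDl. Qed.

Lemma hdotDr H (x y z : H) : hdot z (x + y) = hdot z x + hdot z y.
Proof. exact: linearDr. Qed.

Lemma hdotNl H (x z : H) : hdot (- x) z = - hdot x z.
Proof. exact: linearNl. Qed.

Lemma hdotNr H (x z : H) : hdot z (- x) = - hdot z x.
Proof. exact: linearNr. Qed.

Lemma hdotZl H c (x y : H) : hdot (c *: x) y = c * hdot x y.
Proof. exact: linearZl_LR. Qed.

Lemma hdotZr H c (x y : H) : hdot x (c *: y) = Num.conj c * hdot x y.
Proof. exact: linearZr_LR. Qed.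

Lemma hdotC H (x y : H) : hdot x y = Num.conj (hdot y x).
Proof. by rewrite hermC mul1r. Qed.

Lemma hdot0r H (x : H) : hdot x 0 = 0.
Proof. by rewrite -(scale0r 0) hdotZr conjC0 mul0r. Qed.

Lemma hdot0l H (x : H) : hdot 0 x = 0.
Proof. by rewrite hdotC hdot0r conjC0. Qed.

Lemma Re_conj (a : R[i]) : complex.Re (Num.conj a) = complex.Re a.
Proof. by case: a. Qed.

Lemma conj_real (t : R) : Num.conj t%:C = t%:C.
Proof. exact: conjc_real. Qed.

Lemma rdotC H (x y : H) : rdot x y = rdot y x.
Proof. by rewrite /rdot hdotC Re_conj. Qed.

Lemma rdotDl H (x y z : H) : rdot (x + y) z = rdot x z + rdot y z.
Proof. by rewrite /rdot hdotDl ReD. Qed.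

Lemma rdotDr H (x y z : H) : rdot z (x + y) = rdot z x + rdot z y.
Proof. by rewrite /rdot hdotDr ReD. Qed.

Lemma rdotNl H (x z : H) : rdot (- x) z = - rdot x z.
Proof. by rewrite /rdot hdotNl ReN. Qed.

Lemma rdotNr H (x z : H) : rdot z (- x) = - rdot z x.
Proof. by rewrite /rdot hdotNr ReN. Qed.

Lemma rdotZl H (t : R) (x y : H) : rdot (t%:C *: x) y = t * rdot x y.
Proof. by rewrite /rdot hdotZl ReRM. Qed.

Lemma rdotZr H (t : R) (x y : H) : rdot x (t%:C *: y) = t * rdot x y.
Proof. by rewrite rdotC rdotZl rdotC. Qed.

Definition rdotE := (rdotDl, rdotDr, rdotNl, rdotNr, rdotZl, rdotZr).

Lemma rnorm_sqr H (x : H) : rnorm x ^+ 2 = rdot x x.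
Proof. by rewrite /rdot -hnormE rnormE -rmorphXn. Qed.

Lemma rdot_ge0 H (x : H) : 0 <= rdot x x.
Proof. by rewrite -rnorm_sqr sqr_ge0. Qed.

Lemma rdot_le_norm H (x y : H) : rdot x y <= rnorm x * rnorm y.
Proof.
have [x0|x0] := eqVneq (rnorm x) 0.
  by rewrite x0 mul0r (rnorm_eq0 x0) /rdot hdot0l.
have [y0|y0] := eqVneq (rnorm y) 0.
  by rewrite y0 mulr0 (rnorm_eq0 y0) /rdot hdot0r.
have xp : 0 < rnorm x by rewrite lt_def x0 rnorm_ge0.
have yp : 0 < rnorm y by rewrite lt_def y0 rnorm_ge0.
have := rdot_ge0 ((rnorm y)%:C *: x - (rnorm x)%:C *: y).
rewrite !rdotE -!rnorm_sqr [rdot y x]rdotC => h.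
have : 0 <= 2 * (rnorm x * rnorm y) * (rnorm x * rnorm y - rdot x y) by lra.
by rewrite pmulr_rge0 ?subr_ge0 // !mulr_gt0.
Qed.

Lemma rdot_norm H (x y : H) : `|rdot x y| <= rnorm x * rnorm y.
Proof.
by rewrite ler_norml rdot_le_norm andbT lerNl -rdotNl -rnormN rdot_le_norm.
Qed.

Lemma rdot_sqr_le H (x y : H) : rdot x y ^+ 2 <= rdot x x * rdot y y.
Proof.
rewrite -!rnorm_sqr -exprMn -real_normK ?num_real //.
by rewrite ler_pXn2r ?nnegrE ?mulr_ge0 ?rnorm_ge0 ?rdot_norm.
Qed.

Lemma rdot_eq0 H (x : H) : rdot x x = 0 -> x = 0.
Proof.
by rewrite -rnorm_sqr => /eqP; rewrite sqrf_eq0 => /eqP /rnorm_eq0.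
Qed.

(** The scalars 1 and i recover the real and imaginary parts, so complex identities reduce to real
    ones. *)
Lemma hdot_eq H H' (x y : H) (x' y' : H') :
  (forall c : R[i], rdot (c *: x) y = rdot (c *: x') y') ->
  hdot x y = hdot x' y'.
Proof.
move=> h; have := h 1; have := h 'i; rewrite /rdot !hdotZl !mul1r.
case: (hdot x y) (hdot x' y') => [a b] [a' b'] /=.
by rewrite !mul0r !mul1r !add0r => /oppr_inj -> ->.
Qed.

Lemma hdot_ext H (x y : H) : (forall w, hdot w x = hdot w y) -> x = y.
Proof.
move=> h; apply/eqP; rewrite -subr_eq0; apply/eqP; apply: rdot_eq0.
by rewrite /rdot hdotDr hdotNr h subrr.
Qed.

Lemma closed_subspace_orth (U : normedModType R[i]) H (f : U -> H) (v : H) :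
  lin f -> rbounded f -> closed_subspace [set u | hdot (f u) v = 0].
Proof.
move=> fl [M M0 fM]; split.
- move=> u /closureP Su /=; rewrite -(hdot0l v); apply: hdot_eq => c.
  rewrite scaler0 {2}/rdot hdot0l -(linZ fl); apply/eqP; rewrite -normr_eq0.
  rewrite eq_le normr_ge0 andbT; apply/ler_addgt0Pr => e e0; rewrite add0r.
  (* The Cauchy-Schwarz constant of [u |-> rdot (f (c *: u)) v]; each + 1 keeps it positive, so that
     it can be a denominator. *)
  have K0 : 0 < M * (cabs c + 1) * (rnorm v + 1).
    by rewrite !mulr_gt0 // ltr_wpDl ?cabs_ge0 ?rnorm_ge0.
  have [|y /= fy uy] := Su (e / (M * (cabs c + 1) * (rnorm v + 1))).
    by rewrite divr_gt0.
  have -> : rdot (f (c *: u)) v = rdot (f (c *: (u - y))) v.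
    rewrite scalerBr (linB fl) (linZ fl c y) rdotDl rdotNl {3}/rdot.
    by rewrite hdotZl fy mulr0 /= subr0.
  rewrite (le_trans (rdot_norm _ _)) //.
  have h1 := fM (c *: (u - y)); rewrite rnormZ in h1.
  have h2 : rnorm (f (c *: (u - y))) <= M * (cabs c + 1) * rnorm (u - y).
    rewrite (le_trans h1) // -mulrA ler_pM2l // ler_wpM2r ?rnorm_ge0 //.
    by rewrite lerDl.
  have h3 : rnorm (f (c *: (u - y))) * rnorm v <=
      M * (cabs c + 1) * rnorm (u - y) * (rnorm v + 1).
    by rewrite ler_pM ?rnorm_ge0 // lerDl.
  rewrite (le_trans h3) // mulrAC mulrC -ler_pdivlMr //.
  exact: ltW.
- by rewrite /= (lin0 fl) hdot0l.
- by move=> c x y /= fx fy; rewrite fl hdotDl hdotZl fx fy mulr0 addr0.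
Qed.

Lemma parallelogram H (x y : H) :
  rnorm (x + y) ^+ 2 + rnorm (x - y) ^+ 2 = 2 * rnorm x ^+ 2 + 2 * rnorm y ^+ 2.
Proof. by rewrite !rnorm_sqr !rdotE [rdot y x]rdotC; ring. Qed.

Lemma lin_id (U : normedModType R[i]) : lin (@id U).
Proof. by []. Qed.

Lemma rbounded_id (U : normedModType R[i]) : rbounded (@id U).
Proof. by exists 1 => // u; rewrite mul1r. Qed.

Lemma orth_proj H (W : set H) (x : H) : closed_subspace W ->
  exists2 p, W p & forall w, W w -> hdot w (x - p) = 0.
Proof.
move=> [cW W0 lW].
pose D := [set rnorm (x - w) | w in W]; pose d := inf D.
have infD : has_inf D.
  by split; [exists (rnorm (x - 0)), 0|exists 0 => _ [w _ <-];
    exact: rnorm_ge0].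
have dle w : W w -> d <= rnorm (x - w).
  by move=> Ww; apply: (ge_inf infD.2); exists w.
have d0 : 0 <= d.
  by apply: (lb_le_inf infD.1) => _ [w _ <-]; exact: rnorm_ge0.
have wD w w' c : W w -> W w' -> W (c *: w + w') by move=> ? ?; apply: lW.
have wZ w c : W w -> W (c *: w).
  by move=> Ww; rewrite -[c *: w]addr0; apply: lW.
have /choice[u uP] : forall n, exists w, W w /\ rnorm (x - w) < d + n.+1%:R^-1.
  move=> n; have [|_ [w Ww <-] wd] := @inf_adherent _ D n.+1%:R^-1 _ infD.
    by rewrite invr_gt0.
  by exists w.
have [e e0|p hp] := @cauchy_limit R H u.
  (* For members of W at distance less than d + t from x, with t <= 1, the parallelogram law bounds
     the square of their distance by 4 (d + t)^2 - 4 d^2 <= (8 d + 4) t. *)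
  have K0 : 0 < 8 * d + 5 by rewrite ltr_wpDl // mulr_ge0.
  pose t := Num.min 1 (e ^+ 2 / (8 * d + 5)).
  have t0 : 0 < t by rewrite lt_min ltr01 divr_gt0 ?exprn_gt0.
  have [N hN] := invSn_lt t0; exists N => n m Nn Nm.
  have [Wn un] := uP n; have [Wm um] := uP m.
  have {}un := lt_le_trans un (lerD (lexx d) (ltW (hN n Nn))).
  have {}um := lt_le_trans um (lerD (lexx d) (ltW (hN m Nm))).
  have := parallelogram (x - u n) (x - u m).
  have -> : x - u n - (x - u m) = u m - u n.
    by rewrite opprB addrC addrA subrK.
  have -> : x - u n + (x - u m) =
      2%:C *: (x - (2^-1%:C *: u n + 2^-1%:C *: u m)).
    rewrite scalerBr scalerDr !scalerA -!rmorphM mulfV // !scale1r.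
    by rewrite -[2]/(1 + 1) raddfD /= scalerDl !scale1r opprD addrACA.
  rewrite rdistC rnormZ cabs_real ger0_norm // exprMn.
  have := dle _ (lW 2^-1%:C _ _ Wn (wZ _ 2^-1%:C Wm)).
  have t1 : t <= 1 by rewrite ge_min lexx.
  have te : t * (8 * d + 5) <= e ^+ 2.
    by rewrite -ler_pdivlMr // ge_min lexx orbT.
  clearbody t d; have := rnorm_ge0 (x - u n); have := rnorm_ge0 (x - u m).
  move: (rnorm (x - u n)) (rnorm (x - u m)) un um => a b.
  move: (rnorm (x - _)) (rnorm_ge0 (u n - u m)).
  move: (rnorm (u n - u m)) => z w z0 ad bd b0 a0 dw E.
  have ha : a ^+ 2 <= (d + t) ^+ 2 by rewrite ler_pXn2r ?nnegrE //; lra.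
  have hb : b ^+ 2 <= (d + t) ^+ 2 by rewrite ler_pXn2r ?nnegrE //; lra.
  have hw : d ^+ 2 <= w ^+ 2 by rewrite ler_pXn2r ?nnegrE //; lra.
  have ht : t ^+ 2 <= t by rewrite expr2 ler_piMr // ltW.
  have : z ^+ 2 < e ^+ 2 by nra.
  by rewrite ltr_pXn2r ?nnegrE // ltW.
have Wp : W p.
  apply: cW; apply/closureP => e e0; have [N hN] := hp e e0.
  by exists (u N); [have [] := uP N|exact: hN].
have pd : rnorm (x - p) <= d.
  apply/ler_addgt0Pr => e e0.
  have [|N hN] := hp (e / 2); first by rewrite divr_gt0.
  have [|M hM] := @invSn_lt R (e / 2); first by rewrite divr_gt0.
  have h1 := hN _ (leq_maxl N M); have h2 := hM _ (leq_maxr N M).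
  have h3 := (uP (maxn N M)).2; have h4 := rdistD x (u (maxn N M)) p.
  rewrite [rnorm (u _ - p)]rdistC in h4.
  by move: h1 h2 h3 h4; move: ((maxn N M).+1%:R^-1) => t; lra.
exists p => // w Ww; rewrite -(hdot0l (0 : H)); apply: hdot_eq => c.
rewrite scaler0 [RHS]/rdot hdot0l /=.
have {Ww} := wZ _ c Ww; move: (c *: w) => {c}w Ww.
(* Minimality of p against p + t w. Taking t = <w, x - p> / <w, w> below leaves <w, x - p>^2 <=
   0. *)
have h (t : R) : 2 * t * rdot w (x - p) <= t ^+ 2 * rdot w w.
  have := dle _ (wD _ _ t%:C Ww Wp) => /(le_trans pd).
  rewrite -[_ <= _](@ler_pXn2r _ 2) ?nnegrE ?rnorm_ge0 // !rnorm_sqr.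
  have -> : x - (t%:C *: w + p) = (x - p) - t%:C *: w.
    by rewrite opprD addrA addrAC.
  move: (x - p) => y; rewrite !rdotE [rdot y w]rdotC; lra.
have [w0|w0] := eqVneq (rdot w w) 0.
  by rewrite (rdot_eq0 w0) /rdot hdot0l.
have wp : 0 < rdot w w by rewrite lt_def w0 rdot_ge0.
have := h (rdot w (x - p) / rdot w w).
have -> : 2 * (rdot w (x - p) / rdot w w) * rdot w (x - p) =
  2 * (rdot w (x - p) ^+ 2 / rdot w w) by ring.
have -> : (rdot w (x - p) / rdot w w) ^+ 2 * rdot w w =
  (rdot w (x - p) ^+ 2 / rdot w w) by field.
move=> h1; have h2 : rdot w (x - p) ^+ 2 / rdot w w <= 0 by lra.
apply/eqP; rewrite -sqrf_eq0 eq_le sqr_ge0 andbT.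
by move: h2; rewrite ler_pdivrMr // mul0r.
Qed.

Lemma closed_subspace_setT H (W : set H) : closed_subspace W ->
  (forall x, (forall w, W w -> hdot w x = 0) -> x = 0) -> W = setT.
Proof.
move=> cW h; apply/seteqP; split=> // x _; have [p Wp px] := orth_proj x cW.
by move: (h _ px) => /eqP; rewrite subr_eq0 => /eqP ->.
Qed.

Lemma riesz (U H : hilbertType R) (f : U -> H) (v : H) :
  lin f -> rbounded f -> exists u, forall w, hdot (f w) v = hdot w u.
Proof.
move=> fl fb; have cW := closed_subspace_orth v fl fb.
have [[x fx]|] := pselect (exists x, hdot (f x) v != 0); last first.
  move=> /forallNP h; exists 0 => w; rewrite hdot0r; apply/eqP.
  by apply/negP => hw; apply: (h w); apply/negP.
have [p /= fp px] := orth_proj x cW.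
have fz : hdot (f (x - p)) v = hdot (f x) v.
  by rewrite (linB fl) hdotDl hdotNl fp subr0.
move: (x - p) px fz => z px fz.
have z0 : hdot z z != 0.
  rewrite dnorm_eq0; apply: contra_neq fx => z0.
  by rewrite -fz z0 (lin0 fl) hdot0l.
(* The vector z is orthogonal to the kernel of the functional, a hyperplane; the scalar makes both
   sides agree at z. *)
exists (Num.conj (hdot (f x) v / hdot z z) *: z) => w.
rewrite hdotZr conjCK.
have /px : hdot (f (- (hdot (f w) v / hdot (f x) v) *: z + w)) v = 0.
  by rewrite fl hdotDl hdotZl fz mulNr divfK // addNr.
rewrite hdotDl hdotZl mulNr addrC => /eqP; rewrite subr_eq0 => /eqP ->.
by rewrite mulrACA -mulrA [X in _ * X]mulrC; field; rewrite fx z0.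
Qed.

(** A relation, so that adjoints can be composed without going through the choice made in [adj];
    [adjE] leads back to [adj]. *)
Definition adjoint (U V : hilbertType R) (f : U -> V) (g : V -> U) :=
  forall u v, hdot (f u) v = hdot u (g v).

Section adjoint.
Context (U V : hilbertType R) (f : U -> V) (g : V -> U) (fg : adjoint f g).

Lemma adjoint_sym : adjoint g f.
Proof. by move=> v u; rewrite hdotC -fg -hdotC. Qed.

Lemma radjoint u v : rdot (f u) v = rdot u (g v).
Proof. by rewrite /rdot fg. Qed.

Lemma adjE v : adj f v = g v.
Proof.
rewrite /adj; case: xgetP => [u _ /= fu|h].
  by apply: hdot_ext => w; rewrite -fu fg.
by have := h (g v); case=> w; apply: fg.
Qed.

Lemma lin_adjoint : lin g.
Proof.
move=> c x y; apply: hdot_ext => w.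
by rewrite -fg !hdotDr !hdotZr !fg.
Qed.

Lemma rbounded_adjoint : rbounded f -> rbounded g.
Proof.
move=> [M M0 fM]; exists M => // v.
have [->|g0] := eqVneq (rnorm (g v)) 0;
  first by rewrite mulr_ge0 ?rnorm_ge0 // ltW.
have gp : 0 < rnorm (g v) by rewrite lt_def g0 rnorm_ge0.
rewrite -(ler_pM2r gp) -expr2 rnorm_sqr -radjoint.
rewrite (le_trans (rdot_le_norm _ _)) //.
by rewrite mulrAC ler_wpM2r ?rnorm_ge0.
Qed.

End adjoint.

End hilbert.

(** * C*-algebras: a square root by iteration and the bound on orbit maps *)

Section cstar.
Context {R : realType} {A : cstarAlgType R}.
Implicit Types a b c : A.

Lemma cmulNr a b : cmul a (- b) = - cmul a b.
Proof. by rewrite -scaleN1r cmulZr scaleN1r. Qed.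

Lemma cmulNl a b : cmul (- a) b = - cmul a b.
Proof. by rewrite -scaleN1r cmulZl scaleN1r. Qed.

Lemma cstarN a : cstar (- a) = - cstar a.
Proof. by rewrite -scaleN1r cstarZ rmorphN1 scaleN1r. Qed.

Lemma rnorm_cmul a b : rnorm (cmul a b) <= rnorm a * rnorm b.
Proof. by have := cnormM a b; rewrite !rnormE -rmorphM lecR. Qed.

Lemma rnorm_cstarM a : rnorm (cmul (cstar a) a) = rnorm a ^+ 2.
Proof. by have := cnorm_star a; rewrite !rnormE -rmorphXn => /complexI. Qed.

Lemma rnorm_cstar a : rnorm (cstar a) = rnorm a.
Proof.
suff h b : rnorm b <= rnorm (cstar b).
  by apply/eqP; rewrite eq_le h -{2}(cstarK a) h.
have [->|b0] := eqVneq (rnorm b) 0; first exact: rnorm_ge0.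
have bp : 0 < rnorm b by rewrite lt_def b0 rnorm_ge0.
by rewrite -(ler_pM2r bp) -expr2 -rnorm_cstarM rnorm_cmul.
Qed.

Lemma cmul_sqrB a b : cmul a a - cmul b b = cmul a (a - b) + cmul (a - b) b.
Proof. by rewrite cmulDr cmulDl cmulNr cmulNl addrA subrK. Qed.

(* Iterating [c |-> (b + c^2) / 2] from [0] replaces functional calculus: in the
   unitization the equation says [(1 - c)^2 = 1 - b]. *)
Lemma one_sub_sqrt b : cstar b = b -> rnorm b <= 2^-1 ->
  exists2 c, cstar c = c & c + c - cmul c c = b.
Proof.
move=> bs b1; pose F c := 2^-1%:C *: (b + cmul c c).
pose u n := iter n F (0 : A).
have uS n : u n.+1 = F (u n) by [].
have us n : cstar (u n) = u n.
  elim: n => [|n ih]; first by rewrite /u /= -(scale0r 0)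
    cstarZ conjC0 !scale0r.
  by rewrite uS /F cstarZ cstarD cstarM ih bs conj_real.
have u1 n : rnorm (u n) <= 2^-1.
  elim: n => [|n ih]; first by rewrite rnorm0 invr_ge0.
  rewrite uS rnormZ cabs_real ger0_norm ?invr_ge0 //.
  have h1 := rnormD b (cmul (u n) (u n)); have h2 := rnorm_cmul (u n) (u n).
  have h3 := rnorm_ge0 (u n); nra.
(* On the ball of radius 1/2 squaring has Lipschitz constant 1, and the factor 1/2 in [F] turns it
   into a contraction. *)
have FB c d : rnorm c <= 2^-1 -> rnorm d <= 2^-1 ->
    rnorm (F c - F d) <= 2^-1 * rnorm (c - d).
  move=> c1 d1; rewrite /F -scalerBr rnormZ cabs_real ger0_norm ?invr_ge0 //.
  rewrite opprD addrACA subrr add0r cmul_sqrB ler_wpM2l ?invr_ge0 //.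
  have h1 := rnormD (cmul c (c - d)) (cmul (c - d) d).
  have h2 := rnorm_cmul c (c - d); have h3 := rnorm_cmul (c - d) d.
  have h4 := rnorm_ge0 (c - d); nra.
have dS n : rnorm (u n.+1 - u n) <= 2^-1 ^+ n.
  elim: n => [|n ih].
    rewrite expr0 (le_trans (rnormB _ _)) // rnorm0 addr0 (le_trans (u1 _)) //.
    by rewrite invf_le1 ?ler1n.
  by rewrite uS [X in _ - X]uS (le_trans (FB _ _ _ _)) //
    exprS ler_wpM2l ?invr_ge0.
have dn n k : rnorm (u (n + k)%N - u n) <= 2 * 2^-1 ^+ n - 2 * 2^-1 ^+ (n + k).
  elim: k => [|k ih]; first by rewrite addn0 !subrr rnorm0.
  rewrite addnS (le_trans (rdistD _ (u (n + k)%N) _)) //.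
  by have := dS (n + k)%N; rewrite [_ ^+ (n + k).+1]exprS; move: ih; lra.
have small (e : R) : 0 < e -> exists N, forall n, (N <= n)%N ->
  2 * 2^-1 ^+ n < e.
  move=> e0; have [|N hN] := @invSn_lt R (e / 2); first by rewrite divr_gt0.
  exists N => n Nn; rewrite mulrC -ltr_pdivlMr // (le_lt_trans _ (hN n Nn)) //.
  rewrite exprVn lef_pV2 ?posrE ?exprn_gt0 // -natrX ler_nat; exact: ltn_expl.
have [e e0|l hl] := @cauchy_limit R A u.
  have [N hN] := small e e0; exists N => n m Nn Nm.
  wlog nm : n m Nn Nm / (n <= m)%N.
    by move=> h; case/orP: (leq_total n m) => /h; [|rewrite rdistC]; apply.
  rewrite rdistC -(subnKC nm) (le_lt_trans (dn _ _)) //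
    (le_lt_trans _ (hN n Nn)) //.
  by rewrite gerBl mulr_ge0 // exprn_ge0 // invr_ge0.
exists l.
  apply/eqP; rewrite -subr_eq0; apply/eqP; apply: rnorm_small => e e0.
  have [|N hN] := hl (e / 2); first by rewrite divr_gt0.
  rewrite (le_trans (rdistD _ (u N) _)) // [e]splitr lerD //.
    by rewrite -{1}us -cstarN -cstarD rnorm_cstar ltW // hN.
  by rewrite rdistC ltW // hN.
apply/eqP; rewrite -subr_eq0; apply/eqP; apply: rnorm_small => e e0.
(* The error is at most 2 |l - u_{N+1}| + (|l| + |u_N|) |l - u_N|, and |u_N| <= 1/2. *)
have K0 : 0 < rnorm l + 3 by rewrite ltr_wpDl ?rnorm_ge0.
have [|N hN] := hl (e / (rnorm l + 3)); first by rewrite divr_gt0.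
have -> : l + l - cmul l l - b =
    2%:C *: (l - u N.+1) - (cmul l l - cmul (u N) (u N)).
  rewrite uS /F scalerBr scalerA -rmorphM mulfV // scale1r.
  rewrite -[2]/(1 + 1) raddfD /= scalerDl !scale1r.
  by rewrite opprB opprD !addrA subrK addrAC.
have h1 := hN _ (leqnn N); have h2 := hN _ (leqnSn N).
rewrite (le_trans (rnormB _ _)) // rnormZ cabs_real ger0_norm // cmul_sqrB.
have h3 := rnormD (cmul l (l - u N)) (cmul (l - u N) (u N)).
have h4 := rnorm_cmul l (l - u N); have h5 := rnorm_cmul (l - u N) (u N).
have h6 := rnorm_ge0 (l - u N); have h7 := u1 N; have h8 := rnorm_ge0 l.
have h9 : (rnorm l + 3) * (e / (rnorm l + 3)) = e by rewrite mulrC divfK //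
  gt_eqF.
move: (e / _) h1 h2 h9 => d h1 h2 h9; nra.
Qed.

(** Here [u a] plays the role of rho(a) v, but no operator rho(a) has to exist. For b = 2 c - c^2
    with c self-adjoint, expanding |v - u c|^2 >= 0 gives <v, u b> <= |v|^2. This is applied to b =
    a'^* a', where a' is a rescaled to norm 1/2; the rescaling is the origin of the factor 2. *)
Lemma prerep_bound (H : hilbertType R) (u : A -> H) (v : H) :
  (forall a b, u (a + b) = u a + u b) ->
  (forall (l : R[i]) a, u (l *: a) = l *: u a) ->
  (forall a b, rdot (u a) (u b) = rdot v (u (cmul (cstar a) b))) ->
  forall a, rnorm (u a) <= 2 * rnorm a * rnorm v.
Proof.
move=> uD uZ uM.
have uN a : u (- a) = - u a by rewrite -scaleN1r uZ scaleN1r.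
have small b : cstar b = b -> rnorm b <= 2^-1 -> rdot v (u b) <= rdot v v.
  move=> /one_sub_sqrt h /h[c cs cb].
  have := rdot_ge0 (v - u c); rewrite !rdotE uM cs [rdot (u c) v]rdotC.
  by rewrite -cb uD uN uD !rdotE; lra.
move=> a; have [a0|a0] := eqVneq (rnorm a) 0.
  by rewrite (rnorm_eq0 a0) -(scale0r 0) uZ !scale0r !rnorm0 mulr0 mul0r.
have ap : 0 < rnorm a by rewrite lt_def a0 rnorm_ge0.
have tp : 0 < (2 * rnorm a)^-1 by rewrite invr_gt0 mulr_gt0.
pose a' := (2 * rnorm a)^-1%:C *: a.
have ->: u a = (2 * rnorm a)%:C *: u a'.
  by rewrite uZ scalerA -rmorphM mulfV ?scale1r // mulf_neq0.
rewrite rnormZ cabs_real ger0_norm ?mulr_ge0 ?rnorm_ge0 //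
  ler_pM2l ?mulr_gt0 //.
rewrite -(@ler_pXn2r _ 2) ?nnegrE ?rnorm_ge0 // !rnorm_sqr uM.
apply: small; first by rewrite cstarM cstarK.
rewrite rnorm_cstarM rnormZ cabs_real ger0_norm ?(ltW tp) //.
by rewrite invfM -mulrA mulVf // mulr1 expr2 ler_piMl ?invr_ge0 ?invf_le1
  ?ler1n.
Qed.

End cstar.

(** * Spanning families in Hilbert spaces *)

Section spanning_families.
Context {R : realType}.

(** By sesquilinearity only the Gram matrix matters. This transfers identities between elementary
    tensors to sums before any operator on the tensor product is available. *)
Lemma hdot_comb (X Y : Type) (G G' : hilbertType R) (g : X -> G) (h : Y -> G)
    (g' : X -> G') (h' : Y -> G') l l' :
  (forall x y, hdot (g x) (h y) = hdot (g' x) (h' y)) ->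
  hdot (comb g l) (comb h l') = hdot (comb g' l) (comb h' l').
Proof.
move=> E; rewrite /comb; elim: l => [|p l ih];
  first by rewrite !big_nil !hdot0l.
rewrite !big_cons !hdotDl ih !hdotZl; congr (_ * _ + _).
elim: l' {ih} => [|q l' ih]; first by rewrite !big_nil !hdot0r.
by rewrite !big_cons !hdotDr ih !hdotZr E.
Qed.

Lemma spanning_orthP (X : Type) (G : hilbertType R) (g : X -> G) :
  spanning g <-> (forall u, (forall x, hdot (g x) u = 0) -> u = 0).
Proof.
split=> [/spanningP gT u gu|h].
  apply: rdot_eq0; suff : closed_span (range g) `<=` [set w | hdot w u = 0].
    by rewrite gT /rdot => /(_ u I) /= ->.
  apply: closed_span_min; last by move=> _ [x _ <-]; exact: gu.
  exact: (closed_subspace_orth u (@lin_id _ _) (@rbounded_id _ _)).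
apply/spanningP; apply: closed_subspace_setT; first exact: closed_subspace_span.
by move=> x gx; apply: h => i; apply: gx; apply: sub_closed_span; exists i.
Qed.

Lemma spanning_ext (X : Type) (G : hilbertType R) (g : X -> G) u v :
  spanning g -> (forall x, hdot (g x) u = hdot (g x) v) -> u = v.
Proof.
move=> /spanning_orthP gt h; apply/eqP; rewrite -subr_eq0; apply/eqP;
  apply: gt => x.
by rewrite hdotDr hdotNr h subrr.
Qed.

Lemma spanning_eq (X : Type) (G V : normedModType R[i]) (g : X -> G)
    (f f' : G -> V) : spanning g -> lin f -> lin f' -> rbounded f ->
      rbounded f' ->
  (forall x, f (g x) = f' (g x)) -> forall u, f u = f' u.
Proof.
move=> /spanningP gT fl fl' fb fb' E u.
apply: (eq_closed_span fl fl' fb fb' (S := range g)); last by rewrite gT.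
by move=> _ [x _ <-].
Qed.

Lemma adjoint_ex (U V : hilbertType R) (f : U -> V) :
  lin f -> rbounded f -> exists g, adjoint f g.
Proof.
move=> fl fb; have /choice[g gP] : forall v, exists u,
    forall w, hdot (f w) v = hdot w u by move=> v; apply: riesz.
by exists g => u v; apply: gP.
Qed.

Lemma adjoint_spanning (X Y : Type) (U V : hilbertType R) (gU : X -> U)
  (gV : Y -> V)
    (f : U -> V) (g : V -> U) :
  spanning gU -> spanning gV -> lin f -> rbounded f -> lin g -> rbounded g ->
  (forall x y, hdot (f (gU x)) (gV y) = hdot (gU x) (g (gV y))) -> adjoint f g.
Proof.
move=> tU tV fl fb gl gb E; have [f' ff'] := adjoint_ex fl fb.
have h : forall v, f' v = g v.
  apply: (spanning_eq tV (lin_adjoint ff') gl (rbounded_adjoint ff' fb) gb)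
    => y.
  by apply: (spanning_ext tU) => x; rewrite -ff' E.
by move=> u v; rewrite ff' h.
Qed.

Lemma linA (U V : normedModType R[i]) (f g : U -> V) :
  lin f -> lin g -> lin (fun u => f u + g u).
Proof. by move=> fl gl c u v; rewrite fl gl scalerDr addrACA. Qed.

Lemma rboundedA (U V : normedModType R[i]) (f g : U -> V) :
  rbounded f -> rbounded g -> rbounded (fun u => f u + g u).
Proof.
move=> [M M0 fM] [N N0 gN]; exists (M + N) => [|u]; first exact: addr_gt0.
by rewrite (le_trans (rnormD _ _)) // mulrDl lerD.
Qed.

Lemma linS (U V : normedModType R[i]) (c : R[i]) (f : U -> V) :
  lin f -> lin (fun u => c *: f u).
Proof. by move=> fl d u v; rewrite fl scalerDr !scalerA mulrC. Qed.

Lemma rboundedS (U V : normedModType R[i]) (c : R[i]) (f : U -> V) :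
  rbounded f -> rbounded (fun u => c *: f u).
Proof.
move=> [M M0 fM]; exists ((cabs c + 1) * M) => [|u].
  by rewrite mulr_gt0 // ltr_wpDl ?cabs_ge0.
by rewrite rnormZ -mulrA ler_pM ?cabs_ge0 ?rnorm_ge0 // lerDl.
Qed.

End spanning_families.

(** * Ampliations I (x) X of intertwining operators *)

Section ampliation.
Context {R : realType} {A : cstarAlgType R}.

Lemma bernoulli (x : R) n : 0 <= x -> 1 + n%:R * x <= (1 + x) ^+ n.
Proof.
move=> x0; elim: n => [|n ih]; first by rewrite mul0r addr0.
rewrite exprS -natr1; have : 0 <= (n%:R : R) by [].
move: ih; move: (_ ^+ n) (n%:R) => p m ih m0; nra.
Qed.

(** Log-convexity makes the ratios f(n+1) / f(n) nondecreasing. If the first ratio q exceeded D,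
    then f(n) >= q^n f(0) would outgrow C D^n. *)
Lemma logconvex_growth (f : nat -> R) (C D : R) : 0 < D ->
  (forall n, 0 <= f n) -> (forall n, f n.+1 ^+ 2 <= f n * f n.+2) ->
  (forall n, f n <= C * D ^+ n) -> f 1%N <= D * f 0%N.
Proof.
move=> D0 f0 fc fD; have [//|f1] := lerP (f 1%N) (D * f 0%N).
have f1p : 0 < f 1%N by rewrite (le_lt_trans _ f1) // mulr_ge0 ?f0 // ltW.
have fp0 : 0 < f 0%N.
  rewrite lt_def f0 andbT; apply/eqP => f00; have := fc 0%N.
  by rewrite f00 mul0r leNgt exprn_gt0.
pose q := f 1%N / f 0%N.
have qD : D < q by rewrite ltr_pdivlMr.
have q0 : 0 < q by rewrite (lt_trans D0).
have H n : 0 < f n /\ q * f n <= f n.+1.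
  elim: n => [|n [fn qn]]; first by rewrite /q divfK // gt_eqF.
  have fn1 : 0 < f n.+1 by rewrite (lt_le_trans _ qn) // mulr_gt0.
  split=> //; rewrite -(ler_pM2l fn) (le_trans _ (fc n)) // mulrCA expr2.
  by rewrite mulrA ler_pM2r.
have G n : q ^+ n * f 0%N <= f n.
  elim: n => [|n ih]; first by rewrite mul1r.
  by rewrite exprS -mulrA (le_trans _ (H n).2) // ler_pM2l.
have K n : 1 + n%:R * (q / D - 1) <= C / f 0%N.
  have qD1 : 0 <= q / D - 1 by rewrite subr_ge0 ler_pdivlMr // mul1r ltW.
  rewrite (le_trans (bernoulli n qD1)) // addrC subrK ler_pdivlMr //.
  have -> : (q / D) ^+ n * f 0%N = q ^+ n * f 0%N / D ^+ n.
    by rewrite expr_div_n mulrAC.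
  by rewrite ler_pdivrMr ?exprn_gt0 // (le_trans (G n)).
have x0 : 0 < q / D - 1 by rewrite subr_gt0 ltr_pdivlMr // mul1r.
have := K (Num.truncn (C / f 0%N / (q / D - 1))).+1.
have := Num.Theory.truncnS_gt (C / f 0%N / (q / D - 1)).
rewrite ltr_pdivrMr //; move: (_%:R) => m; move: (C / _) (q / D - 1) => y x.
by lra.
Qed.

(* [is_tensor s tau]: up to unitary equivalence, [tau] is the canonical map
   from F x K to the interior tensor product of F and K over [s]. *)
Record is_tensor (F : hilbertModType A) (K : hilbertType R) (s : starRep A K)
    (G : hilbertType R) (tau : F -> K -> G) : Prop := {
  tenDl : forall x y k, tau (x + y) k = tau x k + tau y k;
  tenZl : forall (c : R[i]) x k, tau (c *: x) k = c *: tau x k;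
  ten_lin : forall x, lin (tau x);
  ten_dot : forall x k x' k',
    hdot (tau x k) (tau x' k') = hdot k (s (ip x x' : A) k');
  ten_spanning : spanning (fun p : F * K => tau p.1 p.2)
}.

(** The field [rep_bounded] gives a bound for each [a] separately; control by the norm of [a] is
    what makes z (x) k bounded in z. *)
Lemma rep_bound (K : hilbertType R) (s : starRep A K) a k :
  rnorm (s a k) <= 2 * rnorm a * rnorm k.
Proof.
apply: (prerep_bound (u := fun a => s a k)) => [b c|c b|b c].
- exact: repD.
- exact: repZ.
- by rewrite /rdot rep_star repM.
Qed.

Lemma lin_rep (K : hilbertType R) (s : starRep A K) a : lin (s a).
Proof. by have /bounded_opP[] := rep_bounded s a. Qed.

Lemma rbounded_rep (K : hilbertType R) (s : starRep A K) a : rbounded (s a).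
Proof. by have /bounded_opP[] := rep_bounded s a. Qed.

Lemma rnorm_ip (F : hilbertModType A) (z : F) :
  rnorm (ip z z : A) = rnorm z ^+ 2.
Proof.
by have := ip_norm (A := A) z; rewrite !rnormE -rmorphXn => /complexI.
Qed.

Section tensor.
Context (F : hilbertModType A) (K : hilbertType R) (s : starRep A K)
  (G : hilbertType R) (tau : F -> K -> G) (ht : is_tensor s tau).

Lemma ten_bound z k : rnorm (tau z k) <= 2 * rnorm z * rnorm k.
Proof.
rewrite -(@ler_pXn2r _ 2) ?nnegrE ?mulr_ge0 ?rnorm_ge0 // rnorm_sqr.
rewrite /rdot (ten_dot ht) (le_trans (rdot_le_norm k _)) //.
have := rep_bound s (ip z z) k; rewrite rnorm_ip => h.
have k0 := rnorm_ge0 k; have := ler_wpM2l k0 h.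
have : 0 <= rnorm k ^+ 2 * rnorm z ^+ 2 by rewrite mulr_ge0 ?sqr_ge0.
by lra.
Qed.

Lemma rbounded_ten z : rbounded (tau z).
Proof.
exists (2 * rnorm z + 1) => [|k].
  by rewrite ltr_wpDl // mulr_ge0 ?rnorm_ge0.
by rewrite (le_trans (ten_bound _ _)) // ler_wpM2r ?rnorm_ge0 // lerDl.
Qed.

Lemma lin_tenl k : lin (tau^~ k).
Proof. by move=> c u v; rewrite (tenDl ht) (tenZl ht). Qed.

Lemma rbounded_tenl k : rbounded (tau^~ k).
Proof.
exists (2 * rnorm k + 1) => [|z].
  by rewrite ltr_wpDl // mulr_ge0 ?rnorm_ge0.
rewrite (le_trans (ten_bound _ _)) // mulrAC.
by rewrite ler_wpM2r ?rnorm_ge0 // lerDl.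
Qed.

Section commutant.
Context (S : K -> K) (SS : adjoint S S) (M : R) (M0 : 0 < M)
  (SM : forall k, rnorm (S k) <= M * rnorm k)
  (Ss : forall a k, S (s a k) = s a (S k)).

(** Stated for lists of coefficients because I (x) S is not yet known to be well defined; this
    estimate is what permits its extension. *)
Lemma amp_norm (l : seq (R[i] * (F * K))) :
  rnorm (comb (fun p => tau p.1 (S p.2)) l) <=
  M * rnorm (comb (fun p => tau p.1 p.2) l).
Proof.
pose v n := comb (fun p : F * K => tau p.1 (iter n S p.2)) l.
have vC n m : rdot (v n.+1) (v m) = rdot (v n) (v m.+1).
  rewrite /rdot /v; congr complex.Re; apply: hdot_comb => p q.
  by rewrite !(ten_dot ht) /= SS Ss.
(* A termwise estimate is enough here: C depends on the list but not on n, and drops out in the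
   growth argument. *)
have [C C0 hC] : exists2 C : R, 0 <= C & forall n, rnorm (v n) <= C * M ^+ n.
  rewrite /v /comb; elim: (l) => [|p l' [C C0 hC]].
    by exists 0 => // n; rewrite big_nil rnorm0 mul0r.
  exists (cabs p.1 * (2 * rnorm p.2.1 * rnorm p.2.2) + C).
    by rewrite addr_ge0 // !mulr_ge0 ?cabs_ge0 ?rnorm_ge0.
  move=> n; rewrite big_cons (le_trans (rnormD _ _)) // mulrDl lerD //.
  rewrite rnormZ -mulrA ler_wpM2l ?cabs_ge0 // (le_trans (ten_bound _ _)) //.
  rewrite -[leRHS]mulrA ler_wpM2l ?mulr_ge0 ?rnorm_ge0 // mulrC.
  elim: n => [|n ih] /=; first by rewrite mul1r.
  by rewrite (le_trans (SM _)) // exprS -mulrA ler_pM2l.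
rewrite -(@ler_pXn2r _ 2) ?nnegrE ?mulr_ge0 ?rnorm_ge0 // ?(ltW M0) //.
rewrite exprMn !rnorm_sqr.
apply: (@logconvex_growth (fun n => rdot (v n) (v n)) (C ^+ 2)) => [|n|n|n].
- exact: exprn_gt0.
- exact: rdot_ge0.
- by rewrite vC rdot_sqr_le.
- rewrite -rnorm_sqr -exprM mulnC exprM -exprMn ler_pXn2r ?nnegrE ?rnorm_ge0 //.
  by rewrite mulr_ge0 // exprn_ge0 // ltW.
Qed.

End commutant.

Lemma amp_ge0 (Q : K -> K) (l : seq (R[i] * (F * K))) :
  adjoint Q Q -> lin Q -> rbounded Q -> (forall a k, Q (s a k) = s a (Q k)) ->
  (forall k, 0 <= rdot (Q k) k) ->
  0 <= rdot (comb (fun p => tau p.1 (Q p.2)) l) (comb (fun p => tau p.1 p.2) l).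
Proof.
move=> QQ Ql [M M0 QM] Qs Q0; pose S k := M%:C *: k - Q k.
have SS : adjoint S S.
  by move=> u v; rewrite hdotDl hdotNl hdotDr hdotNr hdotZl hdotZr conj_real QQ.
have SM k : rnorm (S k) <= M * rnorm k.
  rewrite -(@ler_pXn2r _ 2) ?nnegrE ?mulr_ge0 ?rnorm_ge0 // ?(ltW M0) //.
  rewrite exprMn !rnorm_sqr /S !rdotE.
  (* Positivity of Q at M k - Q k yields |Q k|^2 <= M <Q k, k>, the inequality usually read off from
     a square root of Q. It gives |(M - Q) k| <= M |k|. *)
  have := Q0 (M%:C *: k - Q k); rewrite (linB Ql) (linZ Ql) !rdotE.
  have := rdot_le_norm (Q (Q k)) (Q k); have := QM (Q k).
  have := rdot_ge0 (Q k); rewrite -rnorm_sqr [rdot k (Q k)]rdotC.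
  rewrite (radjoint QQ (Q k) k) -rnorm_sqr => h0 h1 h2.
  have h3 : rdot (Q (Q k)) (Q k) <= M * rnorm (Q k) ^+ 2.
    by rewrite (le_trans h2) // expr2 mulrA ler_wpM2r ?rnorm_ge0.
  move: h3; move: (rdot (Q (Q k)) (Q k)) (rdot (Q k) k) (rdot k k) => x y z.
  move: h0; move: (_ ^+ 2) => w h0 h3 h4.
  have : M * w <= M * (M * y) by lra.
  by rewrite ler_pM2l //; nra.
have Ss a k : S (s a k) = s a (S k).
  by rewrite /S Qs (linB (lin_rep s a)) (linZ (lin_rep s a)).
have := amp_norm SS M0 SM Ss l.
set v := comb (fun p => tau p.1 p.2) l; set w := comb _ l.
have -> : w = M%:C *: v - comb (fun p => tau p.1 (Q p.2)) l.
  rewrite /w /v /comb scaler_sumr -sumrB; apply: eq_bigr => p _.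
  rewrite /S (linB (ten_lin ht _)) (linZ (ten_lin ht _)) scalerBr !scalerA.
  by rewrite [M%:C * _]mulrC.
(* From |M v - u| <= M |v| and Cauchy-Schwarz, M |v|^2 - <u, v> <= M |v|^2. *)
move: (comb _ l) => u h; have := rdot_le_norm (M%:C *: v - u) v.
rewrite rdotDl rdotNl rdotZl -rnorm_sqr => h1.
have := ler_wpM2r (rnorm_ge0 v) h; rewrite -mulrA -expr2; lra.
Qed.

End tensor.

Section functoriality.
Context (F : hilbertModType A) (K1 K2 : hilbertType R) (s1 : starRep A K1)
  (s2 : starRep A K2) (G1 G2 : hilbertType R) (tau1 : F -> K1 -> G1)
  (tau2 : F -> K2 -> G2) (t1 : is_tensor s1 tau1) (t2 : is_tensor s2 tau2)
  (X : K1 -> K2) (Y : K2 -> K1) (XY : adjoint X Y) (Xb : rbounded X)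
  (Xs : forall a k, X (s1 a k) = s2 a (X k)).

Lemma intertwiner_adjoint a h : Y (s2 a h) = s1 a (Y h).
Proof.
apply: hdot_ext => w; rewrite -XY.
have -> : hdot (X w) (s2 a h) = hdot (s2 (cstar a) (X w)) h.
  by rewrite rep_star cstarK.
by rewrite -Xs XY rep_star cstarK.
Qed.

(** The squared norm of the sum of z_i (x) X k_i equals the inner product of the sum of z_i (x) Y X
    k_i with the sum of z_i (x) k_i. Thus [amp_norm] for the self-adjoint operator Y X, which
    commutes with the action, bounds I (x) X. *)
Lemma ampliation : exists Z : G1 -> G2, exists Z' : G2 -> G1,
  [/\ lin Z, rbounded Z, adjoint Z Z',
    forall z k, Z (tau1 z k) = tau2 z (X k) &
    forall z h, Z' (tau2 z h) = tau1 z (Y h)].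
Proof.
have [M M0 YXM] := rbounded_comp (rbounded_adjoint XY Xb) Xb.
have YXa : adjoint (Y \o X) (Y \o X).
  by move=> u v /=; rewrite (adjoint_sym XY) XY.
have YXs a k : (Y \o X) (s1 a k) = s1 a ((Y \o X) k).
  by rewrite /= Xs intertwiner_adjoint.
(* Any C with M <= C^2 serves in place of the square root of M. *)
have [C C0 CM] : exists2 C : R, 0 < C & M <= C ^+ 2.
  exists (M + 1); first by rewrite addr_gt0.
  by rewrite expr2; nra.
have [l|Z [Zl Zb ZE]] := @spanning_extension R _ G1 G2
    (fun p => tau1 p.1 p.2) (fun p => tau2 p.1 (X p.2)) C C0 (ten_spanning t1).
  rewrite -(@ler_pXn2r _ 2) ?nnegrE ?mulr_ge0 ?rnorm_ge0 // ?(ltW C0) //.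
  rewrite exprMn rnorm_sqr.
  have -> : rdot (comb (fun p => tau2 p.1 (X p.2)) l)
        (comb (fun p => tau2 p.1 (X p.2)) l) =
      rdot (comb (fun p => tau1 p.1 ((Y \o X) p.2)) l)
        (comb (fun p => tau1 p.1 p.2) l).
    rewrite /rdot; congr complex.Re; apply: hdot_comb => p q.
    by rewrite (ten_dot t1) (ten_dot t2) (adjoint_sym XY) Xs.
  have h := amp_norm t1 YXa M0 YXM YXs l.
  rewrite (le_trans (rdot_le_norm _ _)) //.
  have := ler_wpM2r (rnorm_ge0 (comb (fun p => tau1 p.1 p.2) l)) h.
  rewrite -mulrA -expr2 => h1; rewrite (le_trans h1) //.
  by rewrite ler_wpM2r ?sqr_ge0.
have [Z' ZZ'] := adjoint_ex Zl (ex_intro2 _ _ C C0 Zb).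
exists Z, Z'; split=> //; first by exists C.
  by move=> z k; exact: (ZE (z, k)).
move=> z h; apply: (spanning_ext (ten_spanning t1)) => -[w k] /=.
have /= <- := ZZ' (tau1 w k); rewrite (ZE (w, k) : Z (tau1 w k) = _).
by rewrite (ten_dot t1) (ten_dot t2) XY intertwiner_adjoint.
Qed.

End functoriality.

End ampliation.

(** * Associativity of the interior tensor product *)

Section associativity.
Context {R : realType} {A : cstarAlgType R} {E : correspondenceType A}
  (K : hilbertType R) (s : starRep A K) (G : hilbertModType A -> hilbertType R)
  (tau : forall F : hilbertModType A, F -> K -> G F)
  (tauP : forall F, is_tensor s (@tau F))
  (tensE : forall F : hilbertModType A, interiorTensor F E).

Let gE (p : E * K) : G E := tau p.1 p.2.

Let gE_spanning : spanning gE. Proof. exact: ten_spanning (tauP E). Qed.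

Lemma lact_bound (a : A) (l : seq (R[i] * (E * K))) :
  rnorm (comb (fun p => tau (lact a p.1) p.2) l)
    <= 2 * rnorm a * rnorm (comb gE l).
Proof.
apply: (prerep_bound (u := fun a => comb (fun p => tau (lact a p.1) p.2) l)).
- move=> b c; rewrite /comb -big_split; apply: eq_bigr => p _ /=.
  by rewrite lactD (tenDl (tauP E)) scalerDr.
- move=> c b; rewrite /comb scaler_sumr; apply: eq_bigr => p _ /=.
  by rewrite lactZ (tenZl (tauP E)) !scalerA mulrC.
- move=> b c; rewrite /rdot; congr complex.Re; apply: hdot_comb => p q.
  by rewrite /gE !(ten_dot (tauP E)) lact_adj lactM.
Qed.

Lemma induced_rep : exists s1 : starRep A (G E),
  forall a y k, s1 a (tau y k) = tau (lact a y) k.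
Proof.
have /choice[rho rhoP] : forall a, exists L : G E -> G E,
    [/\ lin L, rbounded L & forall y k, L (tau y k) = tau (lact a y) k].
  move=> a; have C0 : 0 < 2 * rnorm a + 1.
    by rewrite ltr_wpDl // mulr_ge0 ?rnorm_ge0.
  have [l|L [Ll Lb LE]] := @spanning_extension R _ (G E) (G E) gE
      (fun p => tau (lact a p.1) p.2) _ C0 gE_spanning.
    rewrite (le_trans (lact_bound _ _)) // ler_wpM2r ?rnorm_ge0 //.
    by rewrite lerDl.
  by exists L; split=> // [|y k]; [exists (2 * rnorm a + 1)|exact: (LE (y, k))].
have rl a : lin (rho a) by have [] := rhoP a.
have rb a : rbounded (rho a) by have [] := rhoP a.
have rE a y k : rho a (tau y k) = tau (lact a y) k by have [] := rhoP a.
have r_bounded a : bounded_op (rho a) by apply/bounded_opP; split;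
  [exact: rl|exact: rb].
have rD a b h : rho (a + b) h = rho a h + rho b h.
  move: h; apply: (spanning_eq gE_spanning (rl _) (linA (rl a) (rl b)) (rb _)).
    exact: rboundedA.
  by move=> [y k]; rewrite /gE !rE lactD (tenDl (tauP E)).
have rZ (c : R[i]) a h : rho (c *: a) h = c *: rho a h.
  move: h; apply: (spanning_eq gE_spanning (rl _) (linS c (rl a)) (rb _)).
    exact: rboundedS.
  by move=> [y k]; rewrite /gE !rE lactZ (tenZl (tauP E)).
have rM a b h : rho (cmul a b) h = rho a (rho b h).
  move: h; apply: (spanning_eq gE_spanning (rl _) (lin_comp (rl a) (rl b))
    (rb _)).
    exact: rbounded_comp.
  by move=> [y k]; rewrite /gE /= !rE lactM.
have rA a h k : hdot (rho a h) k = hdot h (rho (cstar a) k).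
  move: h k; apply: (adjoint_spanning gE_spanning gE_spanning) => //
    -[x h] [y k].
  by rewrite /gE !rE !(ten_dot (tauP E)) lact_adj.
by exists (Build_starRep r_bounded rD rZ rM rA); exact: rE.
Qed.

(** The space (F (x) E) (x) K is kept as carrier and only receives a second canonical map, from F x
    (E (x) K). It is bounded in the second argument since |z (x) v|^2 = <v, s1(<z, z>) v>. *)
Lemma tensor_assoc (s1 : starRep A (G E)) :
  (forall a y k, s1 a (tau y k) = tau (lact a y) k) ->
  exists tau1 : forall F : hilbertModType A, F -> G E -> G (tensE F),
    (forall F, is_tensor s1 (@tau1 F)) /\
    forall (F : hilbertModType A) (z : F) y k, tau1 F z (tau y k)
      = tau (itens (tensE F) z y) k.
Proof.
move=> s1E.
have ex (F : hilbertModType A) (z : F) : exists L : G E -> G (tensE F),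
    [/\ lin L, rbounded L &
      forall y k, L (tau y k) = tau (itens (tensE F) z y) k].
  have [M M0 sM] := rbounded_rep s1 (ip z z).
  have C0 : 0 < M + 1 by rewrite addr_gt0.
  have [l|L [Ll Lb LE]] := @spanning_extension R _ (G E) (G (tensE F)) gE
      (fun p => tau (itens (tensE F) z p.1) p.2) _ C0 gE_spanning.
    rewrite -(@ler_pXn2r _ 2) ?nnegrE ?mulr_ge0 ?rnorm_ge0 // ?(ltW C0) //.
    rewrite rnorm_sqr; set v := comb gE l.
    have -> : rdot (comb (fun p => tau (itens (tensE F) z p.1) p.2) l)
        (comb (fun p => tau (itens (tensE F) z p.1) p.2) l) =
        rdot v (s1 (ip z z) v).
      rewrite /rdot; congr complex.Re; rewrite (lin_comb _ _ (lin_rep _ _)).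
      apply: hdot_comb => p q; rewrite /gE /= s1E.
      by rewrite (ten_dot (tauP E)) (ten_dot (tauP _)) itens_ip.
    rewrite (le_trans (rdot_le_norm _ _)) //.
    have := ler_wpM2l (rnorm_ge0 v) (sM v) => h; rewrite (le_trans h) //.
    rewrite mulrCA -expr2 exprMn ler_wpM2r ?sqr_ge0 //; nra.
  by exists L; split=> // [|y k]; [exists (M + 1)|exact: (LE (y, k))].
pose tau1 (F : hilbertModType A) (z : F) := projT1 (cid (ex F z)).
have tl (F : hilbertModType A) (z : F) : lin (tau1 F z)
  by have [] := projT2 (cid (ex F z)).
have tb (F : hilbertModType A) (z : F) : rbounded (tau1 F z)
  by have [] := projT2 (cid (ex F z)).
have tE (F : hilbertModType A) (z : F) y k : tau1 F z (tau y k)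
  = tau (itens (tensE F) z y) k.
  by have [_ _] := projT2 (cid (ex F z)); apply.
exists tau1; split=> // F; split.
- move=> x y; apply: (spanning_eq gE_spanning (tl _ _) (linA (tl _ _) (tl _ _))
    (tb _ _)).
    exact: rboundedA.
  by move=> [z k]; rewrite /gE !tE itensDl (tenDl (tauP _)).
- move=> c x; apply: (spanning_eq gE_spanning (tl _ _) (linS c (tl _ _))
    (tb _ _)).
    exact: rboundedS.
  by move=> [z k]; rewrite /gE !tE itensZl (tenZl (tauP _)).
- exact: tl.
- move=> x k x' k'; have [t' tt'] := adjoint_ex (tl F x) (tb F x).
  (* As an identity of bounded operators, the inner product formula can be tested on elementary
     tensors. *)
  rewrite tt'; suff h v : t' (tau1 F x' v) = s1 (ip x x') v by rewrite h.
  move: v.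
  apply: (spanning_eq gE_spanning (f := t' \o tau1 F x') (f' := s1 (ip x x'))).
  + exact: lin_comp (lin_adjoint tt') (tl _ _).
  + exact: lin_rep.
  + exact: rbounded_comp (rbounded_adjoint tt' (tb _ _)) (tb _ _).
  + exact: rbounded_rep.
  move=> [y h]; apply: (spanning_ext gE_spanning) => -[y' h'] /=.
  rewrite -tt' /gE !tE s1E (ten_dot (tauP _)) (ten_dot (tauP E)).
  by rewrite itens_ip.
apply/spanning_orthP => u hu.
apply: ((spanning_orthP _).1 (ten_spanning (tauP (tensE F)))) => -[w k] /=.
have cs := closed_subspace_orth u (lin_tenl (tauP (tensE F)) k)
  (rbounded_tenl (tauP (tensE F)) k).
have := closed_span_min cs (S := [set z | exists x y, z = itens (tensE F) x y]).
rewrite itens_dense; apply=> // _ [x [y ->]] /=.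
by rewrite -tE; exact: (hu (x, tau y k)).
Qed.

End associativity.

(** * Transfer of the quadratic inequality to F (x) K *)

Section ladder.
Context {R : realType} {A : cstarAlgType R} {E : correspondenceType A}
  (K : hilbertType R) (s : starRep A K) (G : hilbertModType A -> hilbertType R)
  (tau : forall F : hilbertModType A, F -> K -> G F).
Context (tauP : forall F, is_tensor s (@tau F))
  (tensE : forall F : hilbertModType A, interiorTensor F E)
  (s1 : starRep A (G E)) (s1E : forall a y k, s1 a (tau y k) = tau (lact a y) k)
  (tau1 : forall F : hilbertModType A, F -> G E -> G (tensE F)).
Context (tau1P : forall F, is_tensor s1 (@tau1 F))
  (tau1E : forall (F : hilbertModType A) (z : F) (y : E) k,
    tau1 z (tau y k) = tau (itens (tensE F) z y) k)
  (T : G E -> K) (T' : K -> G E) (TT' : adjoint T T') (Tl : lin T)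
  (Tb : rbounded T) (Ts : forall a k, T (s1 a k) = s a (T k))
  (B : forall F, G (tensE F) -> G F) (B' : forall F, G F -> G (tensE F)).
(** [B F] is I_F (x) T from F (x) E (x) K to F (x) K. In [concave] the operator [B'] is taken at E,
    so that its composite with [T'] is the adjoint of T~_2. *)
Context (BB' : forall F, adjoint (@B F) (@B' F)) (Bl : forall F, lin (@B F))
  (Bb : forall F, rbounded (@B F))
  (BE : forall (F : hilbertModType A) (z : F) k, B (tau1 z k) = tau z (T k))
  (B'E : forall (F : hilbertModType A) (z : F) h, B' (tau z h) = tau1 z (T' h))
  (concave : forall k, rnorm (T k) ^+ 2 + rnorm (B' (T' (T k))) ^+ 2 <=
    2 * rnorm (T' (T k)) ^+ 2).

(** Squared norms of bounded maps are continuous; so the inequality need only be checked on finite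
    combinations, or on the range of an operator. *)
Lemma closed_quadratic (U U1 U2 U3 : hilbertType R) (X : U -> U1) (Y : U -> U2)
    (Z : U -> U3) : lin X -> lin Y -> lin Z ->
  rbounded X -> rbounded Y -> rbounded Z ->
  closed [set u | rnorm (X u) ^+ 2 + rnorm (Y u) ^+ 2 <= 2 * rnorm (Z u) ^+ 2].
Proof.
move=> Xl Yl Zl Xb Yb Zb u /closureP Su /=.
have near (U' : hilbertType R) (f : U -> U') (e : R) : lin f -> rbounded f ->
  0 < e ->
    exists2 d, 0 < d & forall y, rnorm (u - y) < d ->
      `|rnorm (f u) ^+ 2 - rnorm (f y) ^+ 2| <= e.
  move=> fl [M M0 fM] e0; pose c := rnorm (f u).
  have c0 : 0 <= c by exact: rnorm_ge0.
  have K0 : 0 < 2 * c + 1 by rewrite ltr_wpDl // mulr_ge0.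
  (* If |f u - f y| < t <= 1, the squared norms differ by at most t (2 c + t) <= t (2 c + 1). *)
  pose t := Num.min 1 (e / (2 * c + 1)).
  have t0 : 0 < t by rewrite lt_min ltr01 divr_gt0.
  exists (t / M); first by rewrite divr_gt0.
  move=> y; rewrite ltr_pdivlMr // mulrC => uy.
  have := le_lt_trans (fM (u - y)) uy; rewrite (linB fl) => fuy.
  have t1 : t <= 1 by rewrite ge_min lexx.
  have te : t * (2 * c + 1) <= e by rewrite -ler_pdivlMr // ge_min lexx orbT.
  clearbody t; have h1 := rdistD (f u) (f y) 0; have h2 := rdistD (f y) (f u) 0.
  rewrite !subr0 in h1 h2; rewrite [rnorm (f y - _)]rdistC in h2.
  have y0 := rnorm_ge0 (f y).
  move: h1 h2 fuy; rewrite -/c; clearbody c; move: (rnorm (f u - f y)) => x.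
  move: (rnorm (f y)) y0 => d d0 h1 h2 h3.
  by rewrite ler_norml; apply/andP; split; nra.
apply/ler_addgt0Pr => e e0; have e4 : 0 < e / 4 by rewrite divr_gt0.
have [d1 d10 h1] := near _ X _ Xl Xb e4;
  have [d2 d20 h2] := near _ Y _ Yl Yb e4.
have [d3 d30 h3] := near _ Z _ Zl Zb e4.
have [|y /= Sy] := Su (Num.min d1 (Num.min d2 d3));
  first by rewrite !lt_min d10 d20.
rewrite !lt_min => /and3P[/h1 + /h2 + /h3]; rewrite !ler_norml.
by move=> /andP[? ?] /andP[? ?] /andP[? ?]; lra.
Qed.

Lemma dense_closed (U : normedModType R[i]) (P : set U) (X : Type) (g : X -> U)
  :
  spanning g -> closed P -> (forall l, P (comb g l)) -> forall u, P u.
Proof.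
move=> gt cP gP u; apply: cP; apply/closureP => e /(gt u)[l ul].
by exists (comb g l).
Qed.

Let T'l : lin T'. Proof. exact: lin_adjoint TT'. Qed.
Let T'b : rbounded T'. Proof. exact: rbounded_adjoint TT' Tb. Qed.
Let B'l F : lin (@B' F). Proof. exact: lin_adjoint (@BB' F). Qed.
Let B'b F : rbounded (@B' F). Proof. exact: rbounded_adjoint (@BB' F)
  (@Bb F). Qed.

Let S k := T' (T k).
Let N (k : G E) := B (B' k).
(** Built from sums and scalar multiples only, so that [linA], [linS] and their bounded analogues
    apply. *)
Let Q k := 2%:C *: S (S k) + (-1) *: (S k + S (N (S k))).

Let Ss a k : S (s1 a k) = s1 a (S k).
Proof. by rewrite /S Ts (intertwiner_adjoint TT' Ts). Qed.

Let SS : adjoint S S.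
Proof. by move=> u v; rewrite /S (adjoint_sym TT') TT'. Qed.

Let Sl : lin S. Proof. exact: lin_comp T'l Tl. Qed.
Let Sb : rbounded S. Proof. exact: rbounded_comp T'b Tb. Qed.
Let Nl : lin N. Proof. exact: lin_comp (@Bl _) (@B'l _). Qed.
Let Nb : rbounded N. Proof. exact: rbounded_comp (@Bb _) (@B'b _). Qed.

Let NN : adjoint N N.
Proof. by move=> u v; rewrite /N BB' (adjoint_sym (@BB' E)). Qed.

Let N_tau y h : N (tau y h) = tau y (T (T' h)).
Proof. by rewrite /N B'E BE. Qed.

Let Ns a k : N (s1 a k) = s1 a (N k).
Proof.
move: k; apply: (spanning_eq (ten_spanning (tauP E)) (f := N \o s1 a) (f' :=
  s1 a \o N)).
- exact: lin_comp Nl (lin_rep _ _).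
- exact: lin_comp (lin_rep _ _) Nl.
- exact: rbounded_comp Nb (rbounded_rep _ _).
- exact: rbounded_comp (rbounded_rep _ _) Nb.
- by move=> [y h] /=; rewrite s1E !N_tau s1E.
Qed.

Let Ql : lin Q.
Proof.
apply: linA; first exact: linS (lin_comp Sl Sl).
exact: linS (linA Sl (lin_comp Sl (lin_comp Nl Sl))).
Qed.

Let Qb : rbounded Q.
Proof.
apply: rboundedA; first exact: rboundedS (rbounded_comp Sb Sb).
exact: rboundedS (rboundedA Sb (rbounded_comp Sb (rbounded_comp Nb Sb))).
Qed.

Let QQ : adjoint Q Q.
Proof.
move=> u v; rewrite /Q !hdotDl !hdotDr !hdotZl !hdotZr !hdotDl !hdotDr
  conj_real.
by rewrite rmorphN1 !SS !NN !SS.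
Qed.

Let Qs a k : Q (s1 a k) = s1 a (Q k).
Proof.
by rewrite /Q !Ss Ns Ss !(linD (lin_rep _ _), linZ (lin_rep _ _)).
Qed.

(** Moving factors across, <Q k, k> = 2 |S k|^2 - |T k|^2 - |B' S k|^2. *)
Let Q_ge0 k : 0 <= rdot (Q k) k.
Proof.
have := concave k; rewrite /Q scaleN1r !rdotE (radjoint SS) (radjoint SS (N _)).
rewrite -!rnorm_sqr {3}/S (radjoint (adjoint_sym TT')) -rnorm_sqr.
by rewrite /N (radjoint (@BB' E)) -rnorm_sqr -/(S k); lra.
Qed.

Section level.
Context (F : hilbertModType A).

Let U (v : G (tensE F)) := B' (B v).
Let N2 (v : G (tensE F)) := B (B' v).
(** [U], [N2] and [Op] are I_F (x) S, I_F (x) N and I_F (x) Q on F (x) (E (x) K). *)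
Let Op v := 2%:C *: U (U v) + (-1) *: (U v + U (N2 (U v))).

Let U_tau z k : U (tau1 z k) = tau1 z (S k).
Proof. by rewrite /U BE B'E. Qed.

(** Coherence of the two bracketings: [N2] is defined from F (x) E as a single module, [N] from E
    alone, and both act by T T' on K. *)
Let N2_tau z k : N2 (tau1 z k) = tau1 z (N k).
Proof.
move: k; apply: (spanning_eq (ten_spanning (tauP E)) (f := N2 \o tau1 z) (f' :=
  tau1 z \o N)).
- exact: lin_comp (lin_comp (@Bl _) (@B'l _)) (ten_lin (tau1P F) _).
- exact: lin_comp (ten_lin (tau1P F) _) Nl.
- exact: rbounded_comp (rbounded_comp (@Bb _) (@B'b _)) (rbounded_ten (tau1P F)
    _).
- exact: rbounded_comp (rbounded_ten (tau1P F) _) Nb.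
- by move=> [y h] /=; rewrite N_tau !tau1E /N2 B'E BE.
Qed.

Let Ul : lin U. Proof. exact: lin_comp (@B'l _) (@Bl _). Qed.

Let Opl : lin Op.
Proof.
apply: linA; first exact: linS (lin_comp Ul Ul).
have N2l : lin N2 by exact: lin_comp (@Bl _) (@B'l _).
exact: linS (linA Ul (lin_comp Ul (lin_comp N2l Ul))).
Qed.

Lemma concave_range (v : G (tensE F)) : rnorm (B v)
  ^+ 2 + rnorm (B' (B' (B v))) ^+ 2 <=
  2 * rnorm (B' (B v)) ^+ 2.
Proof.
move: v; apply: (dense_closed (ten_spanning (tau1P F)) (P := [set v | _])).
  apply: (closed_quadratic (X := @B F) (Y := @B' _ \o (@B' F \o @B F))
      (Z := @B' F \o @B F)) => //.
  - exact: lin_comp (@B'l _) (lin_comp (@B'l _) (@Bl _)).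
  - exact: rbounded_comp (@B'b _) (rbounded_comp (@B'b _) (@Bb _)).
  - exact: rbounded_comp (@B'b _) (@Bb _).
move=> l /=; have := amp_ge0 (tau1P F) l QQ Ql Qb Qs Q_ge0.
have -> : comb (fun p => tau1 p.1 (Q p.2)) l = Op (comb (fun p => tau1 p.1 p.2)
  l).
  rewrite (lin_comb _ _ Opl) /comb; apply: eq_bigr => p _; congr (_ *: _) => /=.
  rewrite /Op !U_tau !N2_tau U_tau /Q.
  by rewrite !(linD (ten_lin (tau1P F) _), linZ (ten_lin (tau1P F) _)).
have UU : adjoint U U by move=> u v; rewrite /U (adjoint_sym (@BB' _)) BB'.
move: (comb _ l) => v; rewrite /Op scaleN1r !rdotE (radjoint UU)
  (radjoint UU (N2 _)).
rewrite -!rnorm_sqr {3}/U (radjoint (adjoint_sym (@BB' _))) -rnorm_sqr.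
by rewrite /N2 (radjoint (@BB' _)) -rnorm_sqr -/(U v); lra.
Qed.

(** Orthogonality to F (x) ker T' places g in the closed range of I_F (x) T, where [concave_range]
    extends by continuity. *)
Lemma concave_orth (g : G F) : (forall (z : F) w, T' w = 0 -> hdot (tau z w)
  g = 0) ->
  rnorm g ^+ 2 + rnorm (B' (B' g)) ^+ 2 <= 2 * rnorm (B' g) ^+ 2.
Proof.
move=> gW; pose M := closed_span (range (@B F)).
have cM : closed_subspace M by exact: closed_subspace_span.
have MB v : M (B v) by apply: sub_closed_span; exists v.
have Mg : M g.
  have [p Mp gp] := orth_proj g cM; suff -> : g = p by [].
  apply/eqP; rewrite -subr_eq0; apply/eqP.
  apply: (spanning_orthP _).1 (ten_spanning (tauP F)) _ _ => -[z h] /=.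
  have cN := closed_subspace_orth (g - p) (ten_lin (tauP F) z)
    (rbounded_ten (tauP F) z).
  suff NT : [set h | hdot (tau z h) (g - p) = 0] = setT.
    by have : [set: K] h by []; rewrite -NT.
  (* The subspace contains the range of T, so x orthogonal to it satisfies T' x = 0; but it also
     contains ker T', so x is orthogonal to itself. *)
  apply: (closed_subspace_setT cN) => x xN.
  have NW w : T' w = 0 -> hdot (tau z w) (g - p) = 0.
    move=> w0; rewrite hdotDr hdotNr gW // sub0r; apply/eqP; rewrite oppr_eq0.
    rewrite hdotC; apply/eqP; rewrite -[RHS]conjC0; congr (Num.conj _).
    have cp := closed_subspace_orth (tau z w) (@lin_id _ (G F))
      (@rbounded_id _ _).
    apply: (closed_span_min cp _ Mp) => _ [v _ <-] /=.
    by rewrite BB' B'E w0 (lin0 (ten_lin (tau1P F) _)) hdot0r.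
  have x0 : T' x = 0.
    apply: rdot_eq0; rewrite /rdot -TT'.
    by rewrite xN //= -BE gp.
  by apply: rdot_eq0; rewrite /rdot xN //=; exact: NW.
apply: (closed_quadratic (X := @id (G F)) (Y := @B' _ \o @B' F) (Z := @B' F))
  => //.
- exact: lin_comp.
- exact: rbounded_id.
- exact: rbounded_comp.
apply/closureP => e e0; have /closed_span_rangeP /(_ e e0)[l gl] := Mg.
exists (comb (@B F) l) => //=.
have -> : comb (@B F) l = B (comb id l) by rewrite (lin_comb _ _ (@Bl F)).
exact: concave_range.
Qed.

End level.

(** The bottom level is separate because K is not given as one of the spaces [G F]. *)
Lemma concave_orth0 h : (forall w, T' w = 0 -> hdot w h = 0) ->
  rnorm h ^+ 2 + rnorm (B' (T' h)) ^+ 2 <= 2 * rnorm (T' h) ^+ 2.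
Proof.
move=> hW; pose M := closed_span (range T).
have cM : closed_subspace M by exact: closed_subspace_span.
have [p Mp hp] := orth_proj h cM.
have w0 : T' (h - p) = 0.
  apply: rdot_eq0; rewrite /rdot -TT' hp //; apply: sub_closed_span.
  by exists (T' (h - p)).
have ph : h - p = 0.
  apply: rdot_eq0; rewrite /rdot hdotDr hdotNr hW // hdotC hp // conjC0 subrr.
  by [].
have Mh : M h by move/eqP: ph; rewrite subr_eq0 => /eqP ->.
apply: (closed_quadratic (X := @id K) (Y := @B' _ \o T') (Z := T')) => //.
- exact: lin_comp.
- exact: rbounded_id.
- exact: rbounded_comp.
apply/closureP => e e0; have /closed_span_rangeP /(_ e e0)[l gl] := Mh.
exists (comb T l) => //=.
have -> : comb T l = T (comb id l) by rewrite (lin_comb _ _ Tl).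
exact: concave.
Qed.

End ladder.

(** * Covariant representations and the generating wandering subspace *)

Section covariant.
Context {R : realType} {A : cstarAlgType R} {E : correspondenceType A}.

(** By concavity a drop d at step n recurs at every later step, so after more than a_n / d steps the
    sequence would be negative. *)
Lemma concave_eq0 (a : nat -> R) : (forall n, 0 <= a n) ->
  (forall n, a n + a n.+2 <= 2 * a n.+1) ->
  (forall e : R, 0 < e -> exists N, forall n, (N <= n)%N -> a n < e) ->
    a 0%N = 0.
Proof.
move=> a0 ac alim; have mono n : a n <= a n.+1.
  have [//|an] := lerP (a n) (a n.+1); pose d := a n - a n.+1.
  have d0 : 0 < d by rewrite subr_gt0.
  have dk k : d <= a (n + k)%N - a (n + k.+1)%N.
    elim: k => [|k ih]; first by rewrite addn0 addn1.
    by have := ac (n + k)%N; rewrite !addnS in ih *; lra.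
  have ak k : a (n + k)%N <= a n - k%:R * d.
    elim: k => [|k ih]; first by rewrite addn0 mul0r subr0.
    by have := dk k; rewrite -natr1; lra.
  have := ak (Num.truncn (a n / d)).+1.
  have := Num.Theory.truncnS_gt (a n / d); rewrite ltr_pdivrMr //.
  by have := a0 (n + (Num.truncn (a n / d)).+1)%N; lra.
have mono0 n : a 0%N <= a n by elim: n => // n /le_trans; apply.
apply/eqP; rewrite eq_le a0 andbT; apply/ler_addgt0Pr => e /alim[N hN].
by rewrite add0r ltW // (le_lt_trans (mono0 N)) // hN.
Qed.

Lemma closed_subspace_ker (U V : hilbertType R) (f : U -> V) :
  lin f -> rbounded f -> closed_subspace [set u | f u = 0].
Proof.
move=> fl fb; split; last by move=> c u v /= fu fv;
  rewrite fl fu fv scaler0 addr0.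
  move=> u Su; have [cO _ _] := closed_subspace_orth (f u) fl fb.
  apply: rdot_eq0; rewrite /rdot; have /cO /= -> //
    : closure [set v | hdot (f v) (f u) = 0] u.
  by apply: closure_subset Su => v /= ->; rewrite hdot0l.
by rewrite /= lin0.
Qed.

(** Both sides have the same inner product with every y, once phi(a) is moved to y as its
    adjoint. *)
Lemma lact_ract (a b : A) (x : E) : lact a (ract x b) = ract (lact a x) b.
Proof.
pose u := lact a (ract x b) - ract (lact a x) b.
have u0 y : ip y u = 0 :> A.
  rewrite ipD -scaleN1r ipZ ip_ract -[a]cstarK -!lact_adj ip_ract.
  by rewrite scaleN1r subrr.
apply/eqP; rewrite -subr_eq0; apply/eqP/rnorm_eq0/eqP.
by rewrite -sqrf_eq0 -(rnorm_ip (A := A)) u0 rnorm0.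
Qed.

Context (tensE : forall F : hilbertModType A, interiorTensor F E).

Lemma etens_ext m (x x' : nat -> E) : (forall i, (i <= m)%N -> x i = x' i) ->
  etens tensE m x = etens tensE m x'.
Proof.
elim: m => [|m ih] h /=; first exact: h.
by rewrite (ih (fun i im => h i (leqW im))) h.
Qed.

(** The Hilbert space and the family of tensor products vary in the induction: one factor E is
    absorbed into K by associativity. *)
Lemma etens_spanning m (K : hilbertType R) (s : starRep A K)
    (G : hilbertModType A -> hilbertType R)
    (tau : forall F : hilbertModType A, F -> K -> G F) :
  (forall F, is_tensor s (@tau F)) ->
  spanning (fun p : (nat -> E) * K => tau (tpow tensE m) (etens tensE m p.1)
    p.2).
Proof.
elim: m K s G tau => [|m ih] K s G tau tauP; apply/spanning_orthP => u hu.
  apply: ((spanning_orthP _).1 (ten_spanning (tauP E)) u) => -[x k].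
  exact: (hu ((fun=> x), k)).
have [s1 s1E] := induced_rep (E := E) tauP.
have [tau1 [tau1P tau1E]] := tensor_assoc tauP tensE s1E.
apply: ((spanning_orthP _).1 (ih _ s1 (fun F => G (tensE F)) tau1 tau1P) u)
  => -[x k] /=.
have cS := closed_subspace_orth u (ten_lin (tau1P _) (etens tensE m x))
  (rbounded_ten (tau1P _) (etens tensE m x)).
have /spanningP gT := ten_spanning (tauP E).
have := closed_span_min cS (S := range (fun p : E * K => tau E p.1 p.2)).
rewrite gT; apply=> // _ [[y h] _ <-] /=; rewrite tau1E.
(* The factor y is spliced in at index m+1, the last one read by [etens] at m+1. *)
have := hu ((fun i => if (i <= m)%N then x i else y), h); rewrite /= ltnn.
by rewrite (@etens_ext m _ x) // => i ->.
Qed.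

Context {H : hilbertType R} (V : covRep E H)
  (tensH : forall F : hilbertModType A, interiorTensorRep F (sigma V)).

Lemma htensP F : is_tensor (sigma V) (htens (tensH F)).
Proof.
split.
- exact: htensDl.
- exact: htensZl.
- by move=> x c h k; rewrite htensDr htensZr.
- exact: htens_dot.
- apply/spanningP; rewrite -(htens_dense (tensH F)); congr closed_span.
  by apply/seteqP; split=> [_ [[x h] _ <-]|_ [x [h ->]]];
    [exists x, h|exists (x, h)].
Qed.

Lemma Ttilde_uniq m (L L' : tpowH tensE tensH m -> H) :
  is_Ttilde tensE tensH m L -> is_Ttilde tensE tensH m L' -> L = L'.
Proof.
move=> [/bounded_opP[Ll Lb] LE] [/bounded_opP[Ll' Lb'] LE']; apply/funext.
apply: (spanning_eq (etens_spanning (m := m) htensP) Ll Ll' Lb Lb')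
  => -[x h] /=.
by rewrite LE LE'.
Qed.

Lemma TtildeE m (L : tpowH tensE tensH m -> H) :
  is_Ttilde tensE tensH m L -> Ttilde tensE tensH m = L.
Proof.
move=> LT; apply/funext => eta; rewrite /Ttilde; case: xgetP => [L' _ /= L'T|h].
  by rewrite (Ttilde_uniq L'T LT).
by have := h L.
Qed.

(* [A] has no unit and [sigma] may be degenerate, so the covariance relation is
   first used on [sigma b h]; on the complement of the span of these vectors
   both sides vanish, since [x (x) h = 0] there. *)
Lemma covT_lact (L : tpowH tensE tensH 0 -> H) : is_Ttilde tensE tensH 0 L ->
  forall a x h, covT V (lact a x) h = sigma V a (covT V x h).
Proof.
move=> [/bounded_opP[Ll Lb] LE] a x h.
have {}LE y k : covT V y k = L (htens (tensH E) y k)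
  by exact: esym (LE (fun=> y) k).
have Tl y : lin (covT V y) by have /bounded_opP[] := covT_bounded V y.
have Tb y : rbounded (covT V y) by have /bounded_opP[] := covT_bounded V y.
pose M := closed_span (range (fun p : A * H => sigma V p.1 p.2)).
have [p Mp hp] := orth_proj h (closed_subspace_span _ : closed_subspace M).
have u0 b : sigma V b (h - p) = 0.
  apply: rdot_eq0; rewrite /rdot rep_star -repM hdotC hp ?conjC0 //.
  by apply: sub_closed_span; exists (cmul (cstar b) b, h - p).
have T0 y : covT V y (h - p) = 0.
  rewrite LE; suff -> : htens (tensH E) y (h - p) = 0 by rewrite (lin0 Ll).
  by apply: rdot_eq0; rewrite /rdot htens_dot u0 hdot0r.
have {u0}T0 y : covT V y h = covT V y p.
  by apply/eqP; rewrite -subr_eq0 -(linB (Tl y)) T0.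
rewrite !T0.
apply: (eq_closed_span (Tl _) (lin_comp (lin_rep _ a) (Tl x)) (Tb _)
  (rbounded_comp (rbounded_rep _ a) (Tb x)) _ Mp) => _ [[b k] _ <-] /=.
by rewrite -covT_covariant lact_ract !LE htens_balanced.
Qed.

End covariant.

Theorem theorem3p3 (R : realType) (A : cstarAlgType R)
    (E : correspondenceType A) (H : hilbertType R) (V : covRep E H)
    (tensE : forall F : hilbertModType A, interiorTensor F E)
    (tensH : forall F : hilbertModType A, interiorTensorRep F (sigma V))
    (hcb : completely_bounded tensE tensH)
    (h1 : forall eta : tpowH tensE tensH 0,
      `|Ttilde tensE tensH 0 eta| ^+ 2 +
        `|adj (Ttilde tensE tensH 1) (Ttilde tensE tensH 0 eta)| ^+ 2
      <= 2 * `|adj (Ttilde tensE tensH 0) (Ttilde tensE tensH 0 eta)| ^+ 2)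
    (h2 : bounded_below tensE tensH)
    (h3 : completely_contractive tensE tensH)
    (h4 : forall h : H,
      `|adj (Ttilde tensE tensH n) h| @[n --> \oo] --> (0 : R[i]^o)) :
  GWS_property tensE tensH.
Proof.
have tauP := htensP tensH; have [T TT] := hcb.
have [/bounded_opP[Tl Tb] TE0] := TT.
have TE y k : T (htens (tensH E) y k) = covT V y k := TE0 (fun=> y) k.
have [s1 s1E] := induced_rep (E := E) tauP.
have [tau1 [tau1P tau1E]] := tensor_assoc tauP tensE s1E.
(* The intertwining relation required for the ampliation I (x) T. *)
have Ts a k : T (s1 a k) = sigma V a (T k).
  move: k; apply: (spanning_eq (ten_spanning (tauP E)) (f := T \o s1 a)
    (f' := sigma V a \o T)).
  - exact: lin_comp Tl (lin_rep _ _).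
  - exact: lin_comp (lin_rep _ _) Tl.
  - exact: rbounded_comp Tb (rbounded_rep _ _).
  - exact: rbounded_comp (rbounded_rep _ _) Tb.
  by move=> [y h] /=; rewrite s1E !TE (covT_lact TT).
have [T' TT'] := adjoint_ex Tl Tb.
have exB F := ampliation (tau1P F) (tauP F) TT' Tb Ts.
pose B F := projT1 (cid (exB F)).
pose B' F := projT1 (cid (projT2 (cid (exB F)))).
have BP F : [/\ lin (B F), rbounded (B F), adjoint (B F) (B' F),
    forall (z : F) k, B F (tau1 F z k) = htens (tensH F) z (T k) &
    forall (z : F) h, B' F (htens (tensH F) z h) = tau1 F z (T' h)].
  exact: projT2 (cid (projT2 (cid (exB F)))).
have Bl F : lin (B F) by have [] := BP F.
have Bb F : rbounded (B F) by have [] := BP F.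
have BB' F : adjoint (B F) (B' F) by have [] := BP F.
have BE (F : hilbertModType A) (z : F) k :
    B F (tau1 F z k) = htens (tensH F) z (T k) by have [_ _ _ + _] := BP F;
      apply.
have B'E (F : hilbertModType A) (z : F) h :
    B' F (htens (tensH F) z h) = tau1 F z (T' h) by have [_ _ _ _] := BP F;
      apply.
(* Explicit candidates for [Ttilde] and its adjoint, composed from the operators I (x) T; uniqueness
   then identifies them. *)
pose L := nat_rect (fun m => tpowH tensE tensH m -> H) T
  (fun m Lm => Lm \o B (tpow tensE m)).
pose L' := nat_rect (fun m => H -> tpowH tensE tensH m) T'
  (fun m Lm => B' (tpow tensE m) \o Lm).
have Llb m : lin (L m) /\ rbounded (L m).
  elim: m => [//|m [Ll Lb]]; split; first exact: lin_comp Ll (Bl _).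
  exact: rbounded_comp Lb (Bb _).
have LT m : is_Ttilde tensE tensH m (L m).
  split; first by apply/bounded_opP; have [] := Llb m.
  elim: m => [|m ih] x h /=; first exact: TE.
  rewrite -tau1E BE TE; exact: ih.
have LL' m : adjoint (L m) (L' m).
  by elim: m => [//|m ih] u v /=; rewrite ih BB'.
(* Every T~_m has its range inside that of T~, hence orthogonal to the kernel of T~*; this makes the
   kernel wandering. *)
have Lrange m u : exists k, L m u = T k.
  elim: m u => [|m ih] u; [by exists u|exact: ih].
have TL m : Ttilde tensE tensH m = L m by exact: TtildeE.
have adjL m h : adj (Ttilde tensE tensH m) h = L' m h.
  by rewrite TL; exact: adjE (LL' m) h.
have concave k : rnorm (T k) ^+ 2 + rnorm (B' E (T' (T k))) ^+ 2 <=
    2 * rnorm (T' (T k)) ^+ 2.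
  have := h1 k; rewrite !adjL !TL !rnormE -!rmorphXn -raddfD /=.
  by rewrite -[2]/(2%:R) -(rmorph_nat (real_complex R)) -rmorphM lecR.
have T'l := lin_adjoint TT'; have T'b := rbounded_adjoint TT' Tb.
exists [set w | T' w = 0].
  split; first exact: closed_subspace_ker.
  move=> m w eta /= w0 _; rewrite TL; have [k ->] := Lrange m eta.
  by rewrite -(adjoint_sym TT') w0 hdot0l.
apply: closed_subspace_setT; first exact: closed_subspace_span.
move=> h hgen.
have hW w : T' w = 0 -> hdot w h = 0.
  by move=> w0; apply: hgen; apply: sub_closed_span; left.
have hL m (z : tpow tensE m) w : T' w = 0 ->
    hdot (htens (tensH (tpow tensE m)) z w) (L' m h) = 0.
  move=> w0; rewrite -LL'; apply: hgen; apply: sub_closed_span; right.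
  exists m => //; exists (htens (tensH (tpow tensE m)) z w); last by rewrite TL.
  by apply: sub_closed_span; exists z, w.
(* The shift restores the usual indexing: [L' m] is the adjoint of T~_{m+1}, and a_0 is |h|^2. *)
pose a n := if n is m.+1 then rnorm (L' m h) ^+ 2 else rnorm h ^+ 2.
apply: rnorm_eq0; apply/eqP; rewrite -sqrf_eq0 -/(a 0%N); apply/eqP.
apply: concave_eq0 => [[|n]|[|n]|e e0]; rewrite /a ?sqr_ge0 //.
- exact: (concave_orth0 TT' Tl Tb BB' Bb concave hW).
- have := concave_orth tauP s1E tau1P tau1E TT' Tl Tb Ts BB' Bl Bb BE B'E
    concave.
  by move=> /(_ _ _ (hL n)).
(* A norm below 1 dominates its square, so smallness of the norm passes to [a]. *)
have e1 : 0 < Num.min 1 e by rewrite lt_min ltr01.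
have := h4 h => /cvgrPdist_lt /(_ (Num.min 1 e)%:C).
rewrite ltcR => /(_ e1)[N _ hN]; exists N.+1 => -[//|n] Nn /=.
have := hN n Nn; rewrite /= sub0r normrN normr_id adjL rnormE ltcR lt_min.
move=> /andP[x1 xe]; rewrite (le_lt_trans _ xe) // expr2 ler_piMr ?rnorm_ge0 //.
exact: ltW.
Qed.
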